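(* Fix $\beta>0$ large enough. For $L\in\mathbb N$ let $\Lambda=\Lambda_L=[1,L]\times[1,L]\cap\mathbb Z^2$, let $X^*_L=\max_{x\in\Lambda}\eta_x$ under the SOS measure $\pi^0_\Lambda$ with floor at $0$ and zero boundary conditions, and let $\widehat X^*_L=\max_{x\in\Lambda}\eta_x$ under the SOS measure $\hat\pi^0_\Lambda$ with zero boundary conditions and no floor. Then for any diverging sequence $\varphi(L)$ (i.e. $\varphi(L)\to+\infty$ as $L\to\infty$), $$\lim_{L\to\infty}\hat\pi^0_\Lambda\Big(\big|\widehat X^*_L-\tfrac1{2\beta}\log L\big|\ge\varphi(L)\Big)=0,\qquad \lim_{L\to\infty}\pi^0_\Lambda\Big(\big|X^*_L-\tfrac3{4\beta}\log L\big|\ge\varphi(L)\Big)=0 .$$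
   Context: SOS model. For a finite $\Lambda\subset\mathbb Z^2$, $\hat\pi^0_\Lambda$ is the probability measure on functions $\eta:\mathbb Z^2\to\mathbb Z$ with $\eta_x=0$ for $x\notin\Lambda$, with weights proportional to $\exp(-\beta\sum_{x\sim y}|\eta_x-\eta_y|)$, where the sum is over nearest-neighbour pairs of $\mathbb Z^2$ with at least one site in $\Lambda$ and $\beta>0$ is the inverse temperature. The measure with floor $\pi^0_\Lambda$ has the same weights but is restricted to $\eta$ with $\eta_x\ge0$ for all $x\in\Lambda$. *)

(* Defs.v *)
From HB Require Import structures.
From mathcomp Require Import all_boot all_order all_algebra finmap.
From mathcomp Require Import all_classical all_reals all_analysis.

Set Implicit Arguments.
Unset Strict Implicit.
Unset Printing Implicit Defensive.

Import Order.TTheory GRing.Theory Num.Theory.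
Import numFieldNormedType.Exports.

Local Open Scope classical_set_scope.
Local Open Scope ring_scope.

Notation site := (int * int)%type.

Definition config : Type := site -> int.
HB.instance Definition _ := Choice.on config.
HB.instance Definition _ := isPointed.Build config (fun=> 0).

(* The SOS measures live on the countable set of configurations vanishing
   outside a finite set, hence the discrete sigma-algebra. *)
HB.instance Definition _ := @isMeasurable.Build default_measure_display
  config discrete_measurable discrete_measurable0
  discrete_measurableC discrete_measurableU.

Definition nearest_neighbours (x y : site) : Prop :=
  `|x.1 - y.1| + `|x.2 - y.2| = 1.

(* Each unordered pair occurs exactly once: of its two orientations, the
   coordinatewise increasing one is kept. *)
Definition bonds (Lam : {fset site}) : set (site * site) :=
  [set b | [/\ nearest_neighbours b.1 b.2,
               b.1.1 <= b.2.1, b.1.2 <= b.2.2 &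
               b.1 \in Lam \/ b.2 \in Lam]].

(* The finitely supported sum is the genuine one: [bonds Lam] is finite. *)
Definition sos_energy (Lam : {fset site}) (eta : config) : int :=
  \sum_(b \in bonds Lam) `|eta b.1 - eta b.2|.

Definition zero_boundary (Lam : {fset site}) : set config :=
  [set eta | forall x, x \notin Lam -> eta x = 0].

Definition zero_boundary_floor (Lam : {fset site}) : set config :=
  zero_boundary Lam `&` [set eta | forall x, x \in Lam -> 0 <= eta x].

Section sos_measure.
Context {R : realType}.
Variables (beta : R) (Lam : {fset site}).

Definition sos_weight (eta : config) : R :=
  expR (- beta * (sos_energy Lam eta)%:~R).

Section weight_measure.
Variable S : set config.

Definition sos_weight_measure (U : set config) : \bar R :=
  \esum_(eta in S `&` U) (sos_weight eta)%:E.

Let sos_weight_measure0 : sos_weight_measure set0 = 0%E.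
Proof. by rewrite /sos_weight_measure setI0 esum_set0. Qed.

Let sos_weight_measure_ge0 U : (0 <= sos_weight_measure U)%E.
Proof. by apply: esum_ge0 => eta _; rewrite lee_fin expR_ge0. Qed.

Let sos_weight_measure_sigma_additive :
  semi_sigma_additive sos_weight_measure.
Proof.
move=> F mF tF mUF; rewrite /sos_weight_measure setI_bigcupr.
rewrite esum_bigcupT; last 2 first.
- apply/trivIsetP => i j _ _ ij.
  by move/trivIsetP : tF => tF; rewrite setIACA setIid tF// setI0.
- by move=> eta; rewrite lee_fin expR_ge0.
rewrite -(nneseries_esumT (a := fun i => sos_weight_measure (F i))); last first.
  by move=> i; exact: sos_weight_measure_ge0.
by apply: is_cvg_nneseries => n _ _; exact: sos_weight_measure_ge0.
Qed.

HB.instance Definition _ := isMeasure.Build _ _ _ sos_weight_measure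
  sos_weight_measure0 sos_weight_measure_ge0 sos_weight_measure_sigma_additive.

End weight_measure.

(* [mnormalize] divides by the partition function; its second argument is a
   default for a partition function equal to 0 or +oo, which does not occur
   below when 0 < beta. *)
Definition sos_nofloor : probability config R :=
  mnormalize (sos_weight_measure (zero_boundary Lam)) (dirac point).

Definition sos_floor : probability config R :=
  mnormalize (sos_weight_measure (zero_boundary_floor Lam)) (dirac point).

End sos_measure.

Definition box (L : nat) : {fset site} :=
  [fset (i%:Z, j%:Z) | i in iota 1 L, j in iota 1 L]%fset.

(* Heights may be negative, so the maximum starts from the height at (1, 1),
   a site of [box L] when L > 0. *)
Definition max_height (L : nat) (eta : config) : int :=
  \big[Order.max/eta (1, 1)]_(x <- box L) eta x.

(* Main.v *)
From HB Require Import structures.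
Require Import Defs.
From mathcomp Require Import all_boot all_order all_algebra finmap.
From mathcomp Require Import all_classical all_reals all_analysis.
From mathcomp Require Import zify ring lra.

Set Implicit Arguments.
Unset Strict Implicit.
Unset Printing Implicit Defensive.

Import Order.TTheory GRing.Theory Num.Theory.
Import numFieldNormedType.Exports.

Local Open Scope classical_set_scope.
Local Open Scope ring_scope.

(** The heuristic is a balance of energy and entropy. Raising a single site [k]
    above its surroundings costs [expR (- 4 beta k)], four bonds per unit of
    height, and the box has [L ^ 2] sites. Without a floor the highest such
    spike has [L ^ 2 * expR (- 4 beta k)] of order one, so [k] is close to
    [ln L / (2 beta)]. With a floor, a surface lying at height [h] may have
    downward spikes reaching the floor, of total weight
    [L ^ 2 * expR (- 4 beta h)]; being lifted by one makes room for them and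
    costs only the perimeter [4 L]. The surface therefore settles near
    [h = ln L / (4 beta)], and the highest spike stands [ln L / (2 beta)] above.

    Upper bounds come from a Peierls argument. Around a site [x] of height at
    least [h], take a finite set containing [x], bounded by the level set of
    height [h], and of least perimeter ([exists_contour]). It is connected and
    has no holes; since a bond set meeting all plaquettes evenly is a boundary
    ([even_is_bdry]), its boundary is connected through plaquettes
    ([contour_bdry_indecomposable]), and the number of such contours of length
    [n] grows exponentially ([card_contours]). Shifting the inside of the
    contour by one level gains [expR (- beta n)]. Iterating this over all levels
    would lose a constant factor per level; instead [lower_tail] follows two
    events, [x] being deep and [x] together with a neighbour being deep. For the
    latter every contour has length at least [6], so that it decays strictly
    faster and contributes a convergent series, while in its absence only the
    unit square around [x] matters.

    With a floor, lowering the inside of a contour may push some heights to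
    [-1]. Those sites are pushed back one at a time ([restore_floor]): the lower
    tail estimate holds under every constraint that is stable under raising, so
    it still applies after some sites have been restored. Above the level where
    [L * expR (- 4 beta h) <= 1] the total price is only exponential in the
    length of the contour ([floor_upper_tail]).

    Lower bounds use that sites with two even coordinates are independent given
    the other heights. Such a site reaches [k] with probability of order
    [expR (- 4 beta (k - h))] when its four neighbours have average at least [h]
    ([max_ge]). That most sites qualify follows from the lower tail without a
    floor ([few_deep_sites]); with a floor it is the entropic repulsion
    ([few_low_sites]): lift the box by one and let each even site whose
    neighbours are low return to zero or not. *)

(** * Bonds and boundaries of finite sets of sites *)

(** A bond is encoded by its left or lower endpoint and its direction, [true]
    being the vertical one. *)
Notation bond := (site * bool)%type.

Definition translate (d : bool) (x : site) (v : int) : site :=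
  if d then (x.1, x.2 + v) else (x.1 + v, x.2).
Definition src (b : bond) : site := b.1.
Definition tgt (b : bond) : site := translate b.2 b.1 1.

HB.lock Definition touching (D : {fset site}) : {fset bond} :=
  ([fset ((x, d) : bond) | x in D, d in [:: true; false]] `|`
  [fset ((translate d x (-1), d) : bond) | x in D, d in [:: true; false]])%fset.

HB.lock Definition bdry (D : {fset site}) : {fset bond} :=
  [fset b in touching D | (src b \in D) != (tgt b \in D)]%fset.

Lemma translate_tgt d x : translate d (translate d x (-1)) 1 = x.
Proof. by case: d x => -[a b]; rewrite /translate/=; congr (_, _); lia. Qed.

Lemma tgt_translate b : translate b.2 (tgt b) (-1) = b.1.
Proof. by case: b => [[x y] []]; rewrite /tgt /translate/=; congr (_, _); lia. Qed.

Lemma in_touching D b : (b \in touching D) = (src b \in D) || (tgt b \in D).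
Proof.
rewrite touching.unlock in_fsetU; congr (_ || _); apply/imfset2P/idP.
- by move=> [x xD [d _ ->]].
- by move=> xD; exists (src b) => //; exists b.2; [case: b.2|case: b {xD}].
- by move=> [x xD [d _ ->]]; rewrite /tgt /= translate_tgt.
- move=> xD; exists (tgt b) => //; exists b.2; first by case: b.2.
  by rewrite tgt_translate; case: b {xD}.
Qed.

Lemma in_bdry D b : (b \in bdry D) = ((src b \in D) != (tgt b \in D)).
Proof.
rewrite bdry.unlock inE.
rewrite -[X in X = _]/((b \in touching D) && ((src b \in D) != (tgt b \in D))).
rewrite in_touching.
by case: (src b \in D); case: (tgt b \in D).
Qed.

Lemma bdry_touching D b : b \in bdry D -> b \in touching D.
Proof. by rewrite in_bdry in_touching; do 2!case: (_ \in D). Qed.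

Lemma exit_fset (D : {fset site}) (f : nat -> site) :
  injective f -> f 0%N \in D ->
  exists n, (forall i, (i <= n)%N -> f i \in D) /\ f n.+1 \notin D.
Proof.
move=> fI f0.
have [n fn] : exists n, f n \notin D.
  pose s := [seq f i | i <- iota 0 #|` D|.+1].
  case: (boolP (all (mem D) s)) => [/allP sD|/allPn[_ /mapP[i _ ->]]]; last by exists i.
  have : (size s <= size (enum_fset D))%N.
    by apply: uniq_leq_size; [rewrite map_inj_uniq ?iota_uniq|move=> x /sD].
  by rewrite size_map size_iota ltnn.
have ex : exists n, f n \notin D by exists n.
case: (ex_minnP ex) => -[|m] fm min; first by rewrite f0 in fm.
exists m; split=> // i im.
by apply: contraT => /min; rewrite ltnNge im.
Qed.

Lemma translate_inj d x : injective (translate d x).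
Proof. by case: d x => -[a b] u v []; lia. Qed.

Lemma translateD d x u v : translate d (translate d x u) v = translate d x (u + v).
Proof. by case: d; rewrite /translate/= addrA. Qed.

Lemma translate0 d x : translate d x 0 = x.
Proof. by case: d x => -[a b]; rewrite /translate/= addr0. Qed.

(** A finite set cannot contain a whole ray, so every axis direction produces a
    boundary bond. *)
Lemma exit_up (D : {fset site}) d x : x \in D ->
  exists n : nat, (forall i, (i <= n)%N -> translate d x i%:Z \in D) /\
    (translate d x n%:Z, d) \in bdry D.
Proof.
move=> xD; have [||n [nD nE]] := @exit_fset D (fun n => translate d x n%:Z).
- by move=> i j /translate_inj [].
- by rewrite translate0.
exists n; split=> //; rewrite in_bdry /src /tgt/= (nD _ (leqnn n)) translateD.
by rewrite (_ : n%:Z + 1 = n.+1%:Z) ?(negbTE nE)//; lia.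
Qed.

Lemma exit_down (D : {fset site}) d x : x \in D ->
  exists n : nat, (translate d x (- n.+1%:Z), d) \in bdry D.
Proof.
move=> xD; have [||n [nD nE]] := @exit_fset D (fun n => translate d x (- n%:Z)).
- by move=> i j /translate_inj /oppr_inj [].
- by rewrite oppr0 translate0.
exists n; rewrite in_bdry /src /tgt/= (negbTE nE) translateD.
by rewrite (_ : - n.+1%:Z + 1 = - n%:Z) ?(nD _ (leqnn n))//; lia.
Qed.

Lemma uniq_leq_card (K : choiceType) (s : seq K) (A : {fset K}) :
  uniq s -> {subset s <= A} -> (size s <= #|` A|)%N.
Proof. by move=> us sA; exact: uniq_leq_size. Qed.

(** A ray that leaves [D] after [n] steps passes through [n.+1] sites of [D]
    in different lines, each of which ends at its own boundary bond. *)
Lemma exit_near (D : {fset site}) x : x \in D ->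
  exists2 n, (n < #|` bdry D|)%N & (translate false x n%:Z, false) \in bdry D.
Proof.
move=> /(exit_up false)[n [nD nE]]; exists n => //.
have /choice[g gP] : forall i : nat, exists m : nat, (i <= n)%N ->
    (translate true (translate false x i%:Z) m%:Z, true) \in bdry D.
  move=> i; case: (leqP i n) => [/nD/(exit_up true)[m [_ mE]]|_]; last by exists 0%N.
  by exists m.
rewrite -(size_iota 0 n.+1).
pose f i : bond := (translate true (translate false x i%:Z) (g i)%:Z, true).
rewrite -(size_map f); apply: uniq_leq_card.
  rewrite map_inj_uniq ?iota_uniq// => i j [].
  by rewrite /translate/= => /addrI [].
by move=> _ /mapP[i + ->]; rewrite mem_iota add0n ltnS => /andP[_ /gP].
Qed.

(** The exits from the two sites in the transverse direction, and those from [x]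
    along [d], are six different bonds. *)
Lemma bdry_ge6 (D : {fset site}) d x v : v != 0 ->
  x \in D -> translate d x v \in D -> (6 <= #|` bdry D|)%N.
Proof.
move=> v0 xD yD; set y := translate d x v in yD.
have [n1 [_ h1]] := exit_up (~~ d) xD.
have [n2 h2] := exit_down (~~ d) xD.
have [n3 [_ h3]] := exit_up (~~ d) yD.
have [n4 h4] := exit_down (~~ d) yD.
have [n5 [_ h5]] := exit_up d xD.
have [n6 h6] := exit_down d xD.
set s : seq bond := [:: (translate (~~ d) x n1, ~~ d); (translate (~~ d) x (- n2.+1%:Z), ~~ d);
  (translate (~~ d) y n3, ~~ d); (translate (~~ d) y (- n4.+1%:Z), ~~ d);
  (translate d x n5, d); (translate d x (- n6.+1%:Z), d)].
apply: (@uniq_leq_card _ s).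
  rewrite /s /y /= !inE !xpair_eqE.
  by case: (d) x {xD yD h1 h2 h3 h4 h5 h6 s y} => -[a b]; rewrite /translate/= !xpair_eqE; lia.
move=> b; rewrite /s !inE.
by repeat (case/orP => [/eqP -> //|]); move/eqP ->.
Qed.

(** A site is determined by its upward exit bond and its second coordinate. *)
Lemma card_le_bdry (L : nat) (D : {fset site}) :
  (forall x, x \in D -> 1 <= x.2 <= L%:Z) -> (#|` D| <= L * #|` bdry D|)%N.
Proof.
move=> DL.
have /choice[g gP] : forall x : site, exists m : nat, x \in D ->
    (translate true x m%:Z, true) \in bdry D.
  move=> x; case: (boolP (x \in D)) => [/(exit_up true)[m [_ mE]]|_]; last by exists 0%N.
  by exists m.
pose s := [seq (b, i) | b <- enum_fset (bdry D), i <- iota 1 L].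
have -> : (L * #|` bdry D| = size s)%N by rewrite size_allpairs size_iota mulnC.
pose f (x : site) : bond * nat := ((translate true x (g x)%:Z, true), `|x.2|%N).
rewrite -[leqLHS](size_map f); apply: uniq_leq_size.
  rewrite map_inj_in_uniq ?fset_uniq// => -[a b] [a' b'] aD bD [-> _].
  by have := DL _ aD; have := DL _ bD; rewrite /= => h1 h2 h; congr (_, _); lia.
move=> _ /mapP[x xD ->]; apply/allpairsP; exists (f x); split => //=; first exact: gP.
have := DL _ xD; rewrite /f mem_iota /=. case: x xD => a b /= _; lia.
Qed.

(** * Boundaries as even bond sets *)

Definition plaquette (p : site) : seq bond :=
  [:: (p, false); (p, true); (translate true p 1, false); (translate false p 1, true)].

Definition even_on (B : {fset bond}) (p : site) : Prop :=
  ((p, false) \in B) (+) ((p, true) \in B) (+)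
  ((translate true p 1, false) \in B) (+) ((translate false p 1, true) \in B) = false.

Lemma bdry_even D p : even_on (bdry D) p.
Proof.
rewrite /even_on !in_bdry /src /tgt /translate /=.
by do 4 case: (_ \in D).
Qed.

Lemma bond_bound (B : {fset bond}) : exists M : nat, forall b, b \in B ->
  `|b.1.1| < M%:Z /\ `|b.1.2| < M%:Z.
Proof.
exists (\sum_(b <- B) (`|b.1.1| + `|b.1.2|).+1)%N => b bB.
have : ((`|b.1.1| + `|b.1.2|).+1 <= \sum_(b <- B) (`|b.1.1| + `|b.1.2|).+1)%N.
  by rewrite (big_rem b)//= leq_addr.
lia.
Qed.

Section gradient.
Variables (B : {fset bond}) (M : nat).
Hypothesis BM : forall b, b \in B -> `|b.1.1| < M%:Z /\ `|b.1.2| < M%:Z.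
Hypothesis Beven : forall p, even_on B p.

Let hb (n : nat) (y : int) := ((n%:Z - M%:Z, y), false) \in B.
Let vb (n : nat) (y : int) := ((n%:Z - M%:Z, y), true) \in B.
Let row_parity n y := \big[addb/false]_(i < n) hb i y.

Let row_parity_up n y : row_parity n y (+) row_parity n (y + 1) = vb n y.
Proof.
elim: n => [|n IH].
  rewrite /row_parity !big_ord0 /vb; apply/esym/negbTE/negP => /BM /=; lia.
rewrite /row_parity !big_ord_recr /= -!/(row_parity _ _).
have := Beven (n%:Z - M%:Z, y); rewrite /even_on /translate /=.
rewrite (_ : n%:Z - M%:Z + 1 = n.+1%:Z - M%:Z); last by lia.
rewrite -/(hb n y) -/(hb n (y + 1)) -/(vb n y) -/(vb n.+1 y) -IH.
by do 2 case: row_parity; do 2 case: hb; case: vb.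
Qed.

Let row_parity_far n y : M%:Z <= `|y| -> row_parity n y = false.
Proof.
move=> My; rewrite /row_parity big1// => i _.
by apply/negbTE/negP => /BM /=; lia.
Qed.

Let row_parity_right n y : (2 * M <= n)%N -> row_parity n y = false.
Proof.
move=> Mn; have up z : row_parity n z = row_parity n (z + 1).
  have := row_parity_up n z; suff -> : vb n z = false by do 2 case: row_parity.
  by apply/negbTE/negP => /BM /=; lia.
have upn z k : row_parity n z = row_parity n (z + k%:Z).
  elim: k => [|k ->]; first by rewrite addr0.
  by rewrite up; congr row_parity; lia.
by rewrite (upn y (M + `|y|)%N) row_parity_far//; lia.
Qed.

(* counting crossings from the left gives a set whose boundary is [B] *)
Let inside (z : site) := (- M%:Z <= z.1) && row_parity (absz (z.1 + M%:Z)) z.2.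

Lemma even_bounded_is_bdry : exists F : {fset site}, bdry F = B.
Proof.
pose box : {fset site} :=
  [fset (i%:Z - M%:Z, j%:Z - M%:Z) | i in iota 0 (2 * M), j in iota 0 (2 * M)]%fset.
exists [fset z in box | inside z]%fset.
have inF z : (z \in [fset z in box | inside z]%fset) = inside z.
  rewrite in_fset inE /=; case: (boolP (inside z)); rewrite ?andbF//= andbT => /andP[z1 zp].
  apply/imfset2P; case: z z1 zp => a b /= z1 zp.
  have [Mb|bM] := leP M%:Z `|b|; first by rewrite row_parity_far in zp.
  have [Ma|aM] := leqP (2 * M)%N (absz (a + M%:Z)); first by rewrite row_parity_right in zp.
  exists (absz (a + M%:Z)); first by rewrite /= mem_iota; lia.
  exists (absz (b + M%:Z)); first by rewrite /= mem_iota; lia.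
  by congr (_, _); lia.
apply/fsetP => b; rewrite in_bdry !inF; case: b => -[a c] d.
rewrite /src /tgt /translate /inside /=; case: d => /=.
- have [aM|aM] := leP (- M%:Z) a; last first.
    by apply/esym/negbTE/negP => /BM /=; lia.
  rewrite /= negb_eqb row_parity_up /vb.
  by rewrite (_ : (absz (a + M%:Z))%:Z - M%:Z = a) //; lia.
- have [aM|aM] := leP (- M%:Z) a; last first.
    have -> : ((a, c), false) \in B = false by apply/negbTE/negP => /BM /=; lia.
    have [aM'|//] := leP (- M%:Z) (a + 1).
    by rewrite (_ : (absz (a + 1 + M%:Z)) = 0%N) /= ?/row_parity ?big_ord0//; lia.
  have -> : (- M%:Z <= a + 1) = true by lia.
  rewrite (_ : (absz (a + 1 + M%:Z)) = (absz (a + M%:Z)).+1) /=; last by lia.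
  rewrite negb_eqb /row_parity big_ord_recr /= addbA addbb addFb /hb.
  by rewrite (_ : (absz (a + M%:Z))%:Z - M%:Z = a) //; lia.
Qed.
End gradient.

(** On the simply connected lattice a bond set that meets every plaquette in an
    even number of bonds has no curl modulo two, hence is a boundary. *)
Lemma even_is_bdry (B : {fset bond}) :
  (forall p, even_on B p) -> exists F, bdry F = B.
Proof. by move=> Be; have [M BM] := bond_bound B; exact: even_bounded_is_bdry BM Be. Qed.

(** * Contours *)

(** The complement of [D] is connected, said without paths: a finite set of
    outer sites has a bond to the rest of the complement. *)
Definition hole_free (D : {fset site}) : Prop :=
  forall F : {fset site}, F != fset0 -> [disjoint F & D]%fset ->
  exists2 b, b \in bdry F & b \in bdry (D `|` F)%fset.

(** Connectedness, also without paths: every proper part [E] has a bond that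
    stays inside [D]. *)
Definition linked (D : {fset site}) : Prop :=
  forall E : {fset site}, (E `<=` D)%fset -> E != fset0 -> E != D ->
  exists2 b, b \in bdry E & b \notin bdry D.

Definition contour (D : {fset site}) : Prop :=
  [/\ D != fset0, linked D & hole_free D].

(** Along the boundary, [P] holds inside and fails outside: for a level set [P]
    this fixes the sign of the height difference across every boundary bond. *)
Definition bounded_by (P : pred site) (D : {fset site}) : Prop :=
  forall b, b \in bdry D -> P (src b) = (src b \in D) /\ P (tgt b) = (tgt b \in D).

(** Among the sets bounded by [P], one of least perimeter can neither be split
    (a component would have a smaller perimeter) nor have holes (filling one
    would decrease the perimeter). *)
Lemma exists_contour (P : pred site) (Lam D0 : {fset site}) x :
  hole_free Lam -> (D0 `<=` Lam)%fset -> x \in D0 -> bounded_by P D0 ->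
  exists D, [/\ (D `<=` Lam)%fset, x \in D, contour D & bounded_by P D].
Proof.
move=> LamH; have [n] := ubnP #|` bdry D0|; elim: n D0 => // n IH D /ltnSE Dn DLam xD PD.
have DLamP y : y \in D -> y \in Lam by apply/fsubsetP.
(* a competitor whose boundary misses a bond of [bdry D] closes the induction *)
have shrink D' b0 : (D' `<=` Lam)%fset -> x \in D' -> bounded_by P D' ->
    {subset bdry D' <= bdry D} -> b0 \in bdry D -> b0 \notin bdry D' ->
    exists D, [/\ (D `<=` Lam)%fset, x \in D, contour D & bounded_by P D].
  move=> D'Lam xD' PD' sub b0D b0D'; apply: (IH D') => //.
  apply: leq_trans Dn; apply: fproper_ltn_card; rewrite fproperE.
  apply/andP; split; first exact/fsubsetP.
  by apply/fsubsetPn; exists b0.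
(* if [D] splits, the part that contains [x] has a smaller boundary *)
have [Dl|nDl] := pselect (linked D); last first.
  have {nDl}[E [ED [E0 [ED' nb]]]] : exists E : {fset site}, (E `<=` D)%fset /\
      E != fset0 /\ E != D /\ forall b, b \in bdry E -> b \in bdry D.
    apply: contra_notP nDl => nE E ED E0 ED'; apply: contra_notP nE => nb.
    exists E; split=> //; split=> //; split=> // b bE.
    by apply: contra_notT nb => bD; exists b.
  have EDP y : y \in E -> y \in D by apply/fsubsetP.
  wlog xE : E ED E0 ED' nb EDP / x \in E => [wl|].
    have [xE|xE] := boolP (x \in E); first exact: wl xE.
    apply: (wl (D `\` E)%fset); rewrite ?fsubDset ?fsubsetUr//.
    - by apply/fset0Pn; exists x; rewrite inE xE.
    - apply: contra E0 => /eqP DE; apply/eqP/fsetP => y; rewrite !inE.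
      apply/negbTE/negP => yE; have := EDP _ yE; by rewrite -DE inE yE.
    - move=> b; have /implyP := nb b; rewrite !in_bdry !inE.
      have /implyP := EDP (src b); have /implyP := EDP (tgt b).
      by do 2 (case: (_ \in E); case: (_ \in D)) => //=.
    - by move=> y; rewrite inE => /andP[].
    - by rewrite inE xE.
  have /fset0Pn[y] : (D `\` E)%fset != fset0.
    by rewrite fsetD_eq0; apply: contra ED' => DE; rewrite eqEfsubset ED.
  rewrite inE => /andP[yE yD].
  have /(exit_up true)[m [_ b0]] : y \in (D `\` E)%fset by rewrite inE yE.
  set b := (_, _) in b0.
  have key c : c \in bdry (D `\` E)%fset -> c \in bdry D /\ c \notin bdry E.
    have /implyP := nb c; rewrite !in_bdry !inE.
    have /implyP := EDP (src c); have /implyP := EDP (tgt c).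
    by do 2 (case: (_ \in E); case: (_ \in D)) => //=.
  have [bD bE] := key _ b0.
  apply: (shrink E b) => //; first exact: fsubset_trans DLam.
  move=> c cE; have [] := PD _ (nb _ cE).
  have := nb _ cE; move: cE; rewrite !in_bdry.
  have /implyP := EDP (src c); have /implyP := EDP (tgt c).
  by do 2 (case: (_ \in E); case: (_ \in D)) => //=.
(* if [D] has a hole, it lies in [Lam] and filling it shrinks the boundary *)
have [Dh|nDh] := pselect (hole_free D).
  by exists D; split=> //; split=> //; apply/fset0Pn; exists x.
have {nDh}[F [F0 [FD nb]]] : exists F : {fset site}, F != fset0 /\
    [disjoint F & D]%fset /\ forall b, b \in bdry F -> b \notin bdry (D `|` F)%fset.
  apply: contra_notP nDh => nF F F0 FD; apply: contra_notP nF => nb.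
  exists F; split=> //; split=> // b bF.
  by apply: contra_notN nb => bD; exists b.
have FDP y : y \in F -> y \notin D by move=> yF; exact: (fdisjointP FD).
have FLam : (F `<=` Lam)%fset.
  rewrite -fsetD_eq0; apply: contraT => FL.
  have [|b b1 b2] := LamH _ FL; first by apply/fdisjointP => y; rewrite inE => /andP[].
  have /implyP := nb b; move: b1 b2; rewrite !in_bdry !inE.
  have /implyP := DLamP (src b); have /implyP := DLamP (tgt b).
  have /implyP := FDP (src b); have /implyP := FDP (tgt b).
  do 2 (case: (_ \in F); case: (_ \in D); case: (_ \in Lam)) => //=.
have /fset0Pn[y yF] := F0; have [m [_ b0]] := exit_up true yF.
set b := (_, _) in b0; have := nb _ b0.
have subb c : c \in bdry (D `|` F)%fset -> c \in bdry D.
  have /implyP := nb c; rewrite !in_bdry !inE.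
  have /implyP := FDP (src c); have /implyP := FDP (tgt c).
  do 2 (case: (_ \in F); case: (_ \in D)) => //=.
move=> bF; apply: (shrink (D `|` F)%fset b) => //.
- by rewrite fsubUset DLam.
- by rewrite inE xD.
- move=> c cE; have [] := PD _ (subb _ cE); have /implyP := nb c; move: (cE); have := subb _ cE.
  rewrite !in_bdry !inE.
  have /implyP := FDP (src c); have /implyP := FDP (tgt c).
  do 2 (case: (_ \in F); case: (_ \in D)) => //=.
- move: b0 bF; rewrite !in_bdry !inE.
  have /implyP := FDP (src b); have /implyP := FDP (tgt b).
  do 2 (case: (_ \in F); case: (_ \in D)) => //=.
Qed.

(** The boundary of a contour is connected through plaquettes. A part [B] that is
    a union of components meets every plaquette evenly, so it is [bdry F]. No bond
    of [bdry F] joins two sites of [D] or two outer sites, hence linkedness and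
    the absence of holes force [F] to be empty or [D]. *)
Lemma contour_bdry_indecomposable D (B : {fset bond}) : contour D ->
  B != fset0 -> (B `<=` bdry D)%fset ->
  (forall p u v, u \in plaquette p -> v \in plaquette p ->
     u \in B -> v \in bdry D -> v \in B) ->
  B = bdry D.
Proof.
move=> [D0 Dl Dh] B0 BD Bcl.
have BDP b : b \in B -> b \in bdry D by apply/fsubsetP.
have [p|F FB] := @even_is_bdry B.
  have := bdry_even D p; rewrite /even_on.
  have in_p u : u \in plaquette p -> forall v, v \in plaquette p ->
      [==> (u \in B), (v \in bdry D) => (v \in B)].
    by move=> up v vp; apply/implyP => uB; apply/implyP; exact: Bcl up vp uB.
  set u1 := (p, false); set u2 := (p, true); set u3 := (_, _); set u4 := (_, _).
  have i1 : u1 \in plaquette p by rewrite !inE eqxx.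
  have i2 : u2 \in plaquette p by rewrite !inE eqxx !orbT.
  have i3 : u3 \in plaquette p by rewrite !inE eqxx !orbT.
  have i4 : u4 \in plaquette p by rewrite !inE eqxx !orbT.
  have /implyP := BDP u1; have /implyP := BDP u2.
  have /implyP := BDP u3; have /implyP := BDP u4.
  have := in_p _ i1 _ i2; have := in_p _ i1 _ i3; have := in_p _ i1 _ i4.
  have := in_p _ i2 _ i1; have := in_p _ i2 _ i3; have := in_p _ i2 _ i4.
  have := in_p _ i3 _ i1; have := in_p _ i3 _ i2; have := in_p _ i3 _ i4.
  have := in_p _ i4 _ i1; have := in_p _ i4 _ i2; have := in_p _ i4 _ i3.
  by do 4 (case: (_ \in bdry D) => //=; case: (_ \in B) => //=).
have FBP b : b \in bdry F -> b \in bdry D by rewrite FB; exact: BDP.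
have sub : (F `<=` D)%fset.
  rewrite -fsetD_eq0; apply: contraT => FD0.
  have [|b b1 b2] := Dh _ FD0; first by apply/fdisjointP => y; rewrite inE => /andP[].
  have /implyP := FBP b; move: b1 b2; rewrite !in_bdry !inE.
  by do 2 (case: (_ \in F); case: (_ \in D)).
have subP y : y \in F -> y \in D by apply/fsubsetP.
have [FD|FD] := eqVneq F D; first by rewrite -FB FD.
have F0 : F != fset0.
  apply: contra_neq B0 => F0; rewrite -FB; apply/fsetP => b.
  by rewrite in_bdry F0 !inE.
have [b b1 b2] := Dl _ sub F0 FD.
by move: b2; rewrite (FBP _ b1).
Qed.

(** * Counting contours *)

(** Moves by at most one in each coordinate, encoded with a shift by one, followed
    by a free choice of direction. Sides of a common plaquette are one move apart,
    so that trails made of such moves can follow a boundary. *)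
Definition offset := ('I_3 * 'I_3 * bool)%type.

Definition hop (a : offset) (b : bond) : bond :=
  ((b.1.1 + a.1.1%:Z - 1, b.1.2 + a.1.2%:Z - 1), a.2).

Lemma hop_plaquette p (u v : bond) :
  u \in plaquette p -> v \in plaquette p -> exists a, v = hop a u.
Proof.
move=> up vp.
have [b1 b2] : (absz (v.1.1 - u.1.1 + 1)%R < 3)%N /\ (absz (v.1.2 - u.1.2 + 1)%R < 3)%N.
  move: up vp; rewrite !inE => /or4P[] /eqP -> /or4P[] /eqP -> /=; split; lia.
have [c1 c2] : - 1 <= v.1.1 - u.1.1 /\ - 1 <= v.1.2 - u.1.2.
  move: up vp; rewrite !inE => /or4P[] /eqP -> /or4P[] /eqP -> /=; split; lia.
exists (Ordinal b1, Ordinal b2, v.2).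
move: u v {up vp} b1 b2 c1 c2 => [[u1 u2] d] [[v1 v2] d'] /= b1 b2 c1 c2.
by rewrite /hop /=; congr (_, _, _); lia.
Qed.

Lemma hop_back a u : exists a', hop a' (hop a u) = u.
Proof.
have h (i : 'I_3) : (2 - i < 3)%N by lia.
exists (Ordinal (h a.1.1), Ordinal (h a.1.2), u.2).
move: u a => [[x y] d] [[i j] d'] /=.
by have := ltn_ord i; have := ltn_ord j; rewrite /hop /= => hi hj; congr (_, _, _); lia.
Qed.

Fixpoint trail (b : bond) (w : seq offset) : seq bond :=
  b :: if w is a :: w' then trail (hop a b) w' else [::].

Lemma trail_cat b w1 w2 : trail b (w1 ++ w2) =
  trail b w1 ++ behead (trail (last b (trail b w1)) w2).
Proof.
elim: w1 b => [|a w IH] b /=; first by case: w2.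
rewrite IH; congr (_ :: _ ++ _); congr (behead (trail _ _)).
by case: w {IH}.
Qed.

Lemma trail_split b w u : u \in trail b w ->
  exists w1 w2, w = w1 ++ w2 /\ last b (trail b w1) = u.
Proof.
elim: w b => [|a w IH] b /=; first by rewrite inE => /eqP ->; exists [::], [::].
rewrite inE => /orP[/eqP ->|/IH[w1 [w2 [-> h]]]]; first by exists [::], (a :: w).
by exists (a :: w1), w2; split=> //=; rewrite -h; case: (w1).
Qed.

(** A detour [u -> hop a u -> u] adds one bond to a trail visiting [u]. *)
Lemma trail_detour b w u a : u \in trail b w ->
  exists w', size w' = (size w).+2 /\
    trail b w' =i [predU1 hop a u & trail b w].
Proof.
move=> /trail_split[w1 [w2 [-> h]]]; have [a' ha'] := hop_back a u.
exists (w1 ++ [:: a, a' & w2]); split; first by rewrite !size_cat /= !addnS.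
have ut : u \in trail b w1.
  rewrite -h; have -> : trail b w1 = b :: behead (trail b w1) by case: (w1).
  exact: (mem_last b (behead (trail b w1))).
move=> v; rewrite !trail_cat h /= ha' !inE !mem_cat !inE.
case: w2 => [|c w2] /=; rewrite ?inE ?in_nil ?in_cons.
  by case: (v =P u) => [->|_]; rewrite ?ut ?orbT ?orbF// orbC.
by case: (v =P u) => [->|_]; rewrite ?ut ?orbT ?orbF//= orbCA.
Qed.

(** As long as a trail misses a bond of the boundary, the part it visits is not
    closed under sharing a plaquette, and a detour of two moves reaches a new
    bond. *)
Lemma contour_trail D b : contour D -> b \in bdry D ->
  exists w, size w = (2 * #|` bdry D|.-1)%N /\ trail b w =i bdry D.
Proof.
move=> Dc bD.
suff : forall m, (m < #|` bdry D|)%N -> exists w,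
    [/\ size w = (2 * m)%N, {subset trail b w <= bdry D} &
        #|` [fset x in trail b w]%fset| = m.+1].
  have card0 : (0 < #|` bdry D|)%N by rewrite cardfs_gt0; apply/fset0Pn; exists b.
  move=> /(_ #|` bdry D|.-1); rewrite prednK// => /(_ (leqnn _))[w [ws wD wc]].
  exists w; split=> // u; apply/idP/idP => [/wD//|].
  suff -> : bdry D = [fset x in trail b w]%fset by rewrite in_fset.
  apply/esym/eqP; rewrite eqEfcard wc leqnn andbT.
  by apply/fsubsetP => x; rewrite in_fset; exact: wD.
elim=> [|m IH] mD.
  exists [::]; split=> //; first by move=> x; rewrite inE => /eqP ->.
  by rewrite (_ : [fset x in _]%fset = [fset b]%fset) ?cardfs1//; apply/fsetP => x; rewrite in_fset /= !inE.
have {IH}[w [ws wD wc]] := IH (ltnW mD).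
set B := [fset x in trail b w]%fset in wc.
have BP x : (x \in B) = (x \in trail b w) by rewrite in_fset.
have [u uB [a [aD aB]]] : exists2 u, u \in trail b w &
    exists a, hop a u \in bdry D /\ hop a u \notin trail b w.
  apply: contrapT => nex; move: mD; suff <- : B = bdry D by rewrite wc ltnn.
  apply: contour_bdry_indecomposable => //.
  - by apply/fset0Pn; exists b; rewrite BP; case: (w) => *; rewrite inE eqxx.
  - by apply/fsubsetP => x; rewrite BP; exact: wD.
  - move=> p u v up vp; rewrite !BP => uB vD; apply: contra_notT nex => vB.
    by have [a va] := hop_plaquette up vp; exists u => //; exists a; rewrite -va.
have [w' [ws' wE]] := trail_detour a uB.
exists w'; split.
- by rewrite ws' ws mulnS.
- by move=> x; rewrite wE inE => /orP[/eqP ->|/wD].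
- rewrite (_ : [fset x in _]%fset = (hop a u |` B)%fset); last first.
    by apply/fsetP => x; rewrite in_fset wE !inE -BP.
  by rewrite cardfsU1 BP aB wc.
Qed.


(** A finite set is recovered from its boundary: the symmetric difference of
    two sets with the same boundary would have none. *)
Lemma bdry_inj : injective bdry.
Proof.
move=> D D' e; apply/fsetP => x; apply/eqP; apply: contraT => xDD'.
have xS : x \in ((D `\` D') `|` (D' `\` D))%fset.
  by move: xDD'; rewrite !inE; do 2 case: (x \in _).
have [n [_]] := exit_up true xS; set b := (_, _).
have : (b \in bdry D) = (b \in bdry D') by rewrite e.
rewrite !in_bdry !inE.
by do 2 (case: (_ \in D); case: (_ \in D')).
Qed.

(** A contour is encoded by the distance at which the horizontal ray from [x]
    leaves it and by a trail through its boundary starting there. *)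
Lemma card_contours x n (C : {fset {fset site}}) :
  (forall D, D \in C -> [/\ contour D, x \in D & #|` bdry D| = n]) ->
  (#|` C| <= n * 18 ^ (2 * n.-1))%N.
Proof.
move=> CP.
have /choice[f fP] D : exists c : nat * seq offset, D \in C ->
   [/\ (c.1 < n)%N, size c.2 = (2 * n.-1)%N &
       trail (translate false x c.1%:Z, false) c.2 =i bdry D].
  case: (boolP (D \in C)) => [/CP[Dc xD Dn]|_]; last by exists (0%N, [::]).
  have [m mn mD] := exit_near xD; have [w [ws wE]] := contour_trail Dc mD.
  by exists (m, w) => _; rewrite -Dn.
pose s := [seq (i, tval w) | i <- iota 0 n, w <- enum {: (2 * n.-1).-tuple offset}].
have -> : (n * 18 ^ (2 * n.-1) = size s)%N.
  rewrite size_allpairs size_iota -cardE card_tuple /offset !card_prod card_ord.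
  by rewrite card_bool.
rewrite -(size_map f); apply: uniq_leq_size.
  rewrite map_inj_in_uniq ?fset_uniq// => D D' DC D'C e.
  have [_ _ h] := fP _ DC; have [_ _ h'] := fP _ D'C.
  by apply: bdry_inj; apply/fsetP => b; rewrite -h -h' e.
move=> _ /mapP[D DC ->]; have [h1 h2 _] := fP _ DC.
have h3 : size (f D).2 == (2 * n.-1)%N by apply/eqP.
apply/allpairsP; exists ((f D).1, Tuple h3) => /=; split.
- by rewrite mem_iota.
- by rewrite mem_enum.
- by case: (f D).
Qed.
(** The factor [n] of [card_contours] is absorbed in [2 ^ n], which leaves a
    geometric series starting at the power [6]. *)
Lemma contour_sum (R : realType) (r : R) (K : nat) x (C : {fset {fset site}}) :
  (2 * 18 ^ 2 <= K)%N -> 0 <= r -> K%:R * r <= 2^-1 ->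
  (forall D, D \in C -> [/\ contour D, x \in D & (6 <= #|` bdry D|)%N]) ->
  \sum_(D <- C) r ^+ #|` bdry D| <= 2 * (K%:R * r) ^+ 6.
Proof.
move=> K18 r0 rs CP; set q := K%:R * r.
have q0 : 0 <= q by rewrite mulr_ge0.
have [N CN] : exists N : nat, forall D, D \in C -> (#|` bdry D| < 6 + N)%N.
  exists (\sum_(D <- C) #|` bdry D|.+1)%N => D DC.
  by rewrite (big_rem D)//=; lia.
rewrite (partition_big (fun D => inord #|` bdry D| : 'I_(6 + N).+1)
  (fun i : 'I_(6 + N).+1 => true))//=.
have inner (n : 'I_(6 + N).+1) :
    \sum_(D <- C | inord #|` bdry D| == n) r ^+ #|` bdry D| <=
    if (6 <= n)%N then q ^+ n else 0.
  have card_n D : D \in C -> (inord #|` bdry D| == n) = (#|` bdry D| == n).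
    by move=> /CN Dn; rewrite -val_eqE /= inordK// ltnS ltnW.
  pose Cn := [fset D in C | #|` bdry D| == n]%fset.
  have -> : \sum_(D <- C | inord #|` bdry D| == n) r ^+ #|` bdry D| = r ^+ n *+ #|` Cn|.
    rewrite big_seq_cond (eq_bigl (fun D => D \in Cn)); last first.
      by move=> D; rewrite !inE /=; case: (boolP (D \in C)) => //= /card_n ->.
    rewrite (eq_bigr (fun=> r ^+ n)); last first.
      by move=> D; rewrite !inE /= => /andP[_ /eqP ->].
    rewrite big_const_seq iter_addr_0; congr (_ *+ _).
    rewrite -size_filter; apply/perm_size/uniq_perm; rewrite ?filter_uniq ?fset_uniq//.
    move=> D; rewrite mem_filter; case: (boolP (D \in Cn)) => //=.
    by rewrite !inE /= => /andP[].
  have [n6|n6] := leqP 6 n; last first.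
    suff -> : #|` Cn| = 0%N by rewrite mulr0n.
    apply/eqP; rewrite cardfs_eq0; apply/eqP/fsetP => D.
    rewrite !inE /=; apply/negbTE/negP => /andP[/CP[_ _ +] /eqP Dn].
    by rewrite Dn leqNgt n6.
  have cC : (#|` Cn| <= n * 18 ^ (2 * n.-1))%N.
    apply: (@card_contours x) => D; rewrite !inE /= => /andP[/CP[Dc xD _] /eqP Dn].
    by split.
  have cC' : (#|` Cn| <= K ^ n)%N.
    apply: (leq_trans cC); apply: (@leq_trans ((2 * 18 ^ 2) ^ n)); last first.
      by rewrite leq_exp2r// (leq_trans _ n6).
    rewrite expnMn -expnM leq_mul//; first exact: ltnW (ltn_expl _ _).
    by rewrite leq_exp2l// leq_mul// leq_pred.
  rewrite /q exprMn -natrX mulr_natl; apply: ler_wpMn2l cC'.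
  exact: exprn_ge0.
apply: (le_trans (ler_sum _ (fun n _ => inner n))).
rewrite -(big_mkord xpredT (fun n => if (6 <= n)%N then q ^+ n else 0)).
rewrite (@big_cat_nat _ _ _ 6) //=.
rewrite big_nat_cond big1 ?add0r; last first.
  by move=> i /andP[/andP[_ i6] _]; rewrite leqNgt i6.
have -> : \sum_(6 <= i < (6 + N).+1) (if (6 <= i)%N then q ^+ i else 0) =
   q ^+ 6 * \sum_(0 <= i < N.+1) q ^+ i.
  rewrite -addnS addnC -{1}(add0n 6%N) big_addn addnK mulr_sumr.
  by apply: eq_bigr => i _; rewrite leq_addl exprD mulrC.
rewrite mulrC ler_wpM2r ?exprn_ge0//.
have : (1 - q) * \sum_(0 <= i < N.+1) q ^+ i <= 1.
  rewrite big_mkord -[X in (X - q)](expr1n _ N.+1).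
  have := subrXX 1 q N.+1; rewrite expr1n.
  under eq_bigr do rewrite expr1n mul1r.
  by move=> <-; rewrite gerBl exprn_ge0.
have : 0 <= \sum_(0 <= i < N.+1) q ^+ i by apply: sumr_ge0 => i _; exact: exprn_ge0.
have {}rs : q <= 2^-1 by [].
move: (\sum_(0 <= i < N.+1) q ^+ i) => S S0 S1.
have : 2^-1 * S <= (1 - q) * S by apply: ler_wpM2r => //; lra.
by lra.
Qed.

(** * Geometry of the box *)

Lemma in_box L (x : site) : (x \in box L) = (1 <= x.1 <= L%:Z) && (1 <= x.2 <= L%:Z).
Proof.
apply/imfset2P/idP => [[i /= + [j /= + ->]]|]; first by rewrite !mem_iota /=; lia.
case: x => a b /= ab; exists (absz a); first by rewrite /= mem_iota; lia.
exists (absz b); first by rewrite /= mem_iota; lia.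
by congr (_, _); lia.
Qed.

(** A set disjoint from the box has a site on some side of the box, and the
    ray leading away from that side leaves the set without meeting the box. *)
Lemma box_hole_free L : hole_free (box L).
Proof.
move=> F /fset0Pn[x xF] /fdisjointP Fbox.
have xb := Fbox _ xF.
have ray (d s : bool) : exists n : nat,
    (forall i, (i <= n)%N -> translate d x (if s then i%:Z else - i%:Z) \in F) /\
    translate d x (if s then n.+1%:Z else - n.+1%:Z) \notin F.
  apply: (@exit_fset F (fun i => translate d x (if s then i%:Z else - i%:Z))).
    by move=> i j /translate_inj; case: s; lia.
  by rewrite /= oppr0 if_same translate0.
have [d [s ds]] : exists d s, forall i : nat,
    translate d x (if s then i%:Z else - i%:Z) \notin box L.
  move: xb; rewrite in_box !negb_and -!ltNge => /orP[]/orP[] h.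
  - by exists false, false => i; rewrite in_box /translate /=; lia.
  - by exists false, true => i; rewrite in_box /translate /=; lia.
  - by exists true, false => i; rewrite in_box /translate /=; lia.
  - by exists true, true => i; rewrite in_box /translate /=; lia.
have [n [nF nE]] := ray d s.
exists (translate d x (if s then n%:Z else - n.+1%:Z), d).
  rewrite in_bdry /src /tgt /= translateD; case: s {ds ray} nF nE => nF nE.
    rewrite (nF n)// (_ : n%:Z + 1 = n.+1%:Z) ?(negbTE nE)//; lia.
  by rewrite (_ : - n.+1%:Z + 1 = - n%:Z) ?(nF n)// ?(negbTE nE)//; lia.
rewrite in_bdry /src /tgt /= translateD !inE.
case: s ds {ray} nF nE => ds nF nE.
  rewrite (nF n)// (_ : n%:Z + 1 = n.+1%:Z) ?(negbTE nE) ?(negbTE (ds n.+1)) ?orbT//; lia.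
rewrite (_ : - n.+1%:Z + 1 = - n%:Z) ?(nF n)// ?(negbTE nE) ?(negbTE (ds n.+1)) ?orbT//; lia.
Qed.

Lemma card_bdry_box L : (#|` bdry (box L)| <= 4 * L)%N.
Proof.
pose s : seq bond := flatten [seq [:: ((0, i%:Z), false); ((L%:Z, i%:Z), false);
  ((i%:Z, 0), true); ((i%:Z, L%:Z), true)] | i <- iota 1 L].
have -> : (4 * L = size s)%N.
  rewrite size_flatten /shape -map_comp -{1}(size_iota 1 L).
  by elim: (iota 1 L) => //= a l IH; rewrite -IH mulnS.
apply: uniq_leq_size; first exact: fset_uniq.
move=> -[[a b] d]; rewrite in_bdry !in_box /src /tgt /translate /= => h.
have mems i c : i \in iota 1 L -> c \in [:: ((0, i%:Z), false); ((L%:Z, i%:Z), false);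
  ((i%:Z, 0), true); ((i%:Z, L%:Z), true)] -> c \in s.
  by move=> iL cl; apply/flattenP; eexists; [apply/mapP; exists i|].
case: d h => /= h.
- apply: (mems (absz a)); first by rewrite mem_iota; lia.
  by rewrite !inE !xpair_eqE /=; lia.
- apply: (mems (absz b)); first by rewrite mem_iota; lia.
  by rewrite !inE !xpair_eqE /=; lia.
Qed.

Arguments translate : simpl never.

(** * Unordered sums *)

Section esum_tools.
Context {R : realType}.
Local Open Scope ereal_scope.

Lemma le_esumZ (T : choiceType) (I : set T) (a b : T -> \bar R) (c : R) :
  (0 <= c)%R -> (forall i, I i -> 0 <= b i) -> (forall i, I i -> a i <= c%:E * b i) ->
  \esum_(i in I) a i <= c%:E * \esum_(i in I) b i.
Proof.
move=> c0 b0 ab; apply: ge_ereal_sup => _ [X [finX XI] <-].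
have sumb : \sum_(i \in X) b i <= \esum_(i in I) b i.
  by apply: ereal_sup_ubound; exists X.
apply: le_trans (lee_wpmul2l _ sumb); last by rewrite lee_fin.
rewrite !fsbig_finite//= big_seq [X in _ <= _ * X]big_seq ge0_sume_distrr; last first.
  by move=> i; rewrite in_fset_set// inE => /XI/b0.
apply: lee_sum => i.
by rewrite in_fset_set// inE => /XI/ab.
Qed.

Lemma subset_esum (T : choiceType) (I J : set T) (a : T -> \bar R) :
  I `<=` J -> \esum_(i in I) a i <= \esum_(i in J) a i.
Proof.
move=> IJ; apply: ge_ereal_sup => _ [X [finX XI] <-].
by apply: ereal_sup_ubound; exists X => //; split=> //; exact: subset_trans IJ.
Qed.

Lemma esum_transport (T U : choiceType) (A : set T) (B : set U) (f : T -> U)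
    (a : T -> \bar R) (b : U -> \bar R) (c : R) :
  (0 <= c)%R -> (forall x, 0 <= b x) -> set_inj A f ->
  (forall x, A x -> B (f x) /\ a x <= c%:E * b (f x)) ->
  \esum_(x in A) a x <= c%:E * \esum_(x in B) b x.
Proof.
move=> c0 b0 fI AB.
apply: le_trans (@le_esumZ _ A a (b \o f) c c0 _ _) _ => //.
- by move=> x _; exact: b0.
- by move=> x /AB[].
rewrite lee_wpmul2l ?lee_fin//.
rewrite -(@esum_image _ _ _ A f b fI); apply: subset_esum.
by move=> _ [x /AB[Bx _] <-].
Qed.

Lemma esum_slice (T I : choiceType) (A : set T) (g : T -> I) (a : T -> \bar R) :
  (forall x, 0 <= a x) ->
  \esum_(x in A) a x = \esum_(i in setT) \esum_(x in A `&` (g @^-1` [set i])) a x.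
Proof.
move=> a0; rewrite (esum_esum (a := fun _ x => a x))//.
apply: reindex_esum; split.
- by move=> [i x] [_ []].
- by move=> [i x] [j y]; rewrite !inE /= => -[_ [_ <-]] [_ [_ <-]] ->.
- by move=> x Ax; exists (g x, x).
Qed.

Lemma int_geometric_bound (q : R) : (0 <= q < 1)%R -> exists c : R,
  (0 < c)%R /\ \esum_(v in [set: int]) (q ^+ `|v|)%:E <= c%:E.
Proof.
move=> /andP[q0 q1].
have nat_bound : \esum_(n in [set: nat]) (q ^+ n)%:E <= ((1 - q)^-1)%:E.
  rewrite -nneseries_esumT; last by move=> n; rewrite lee_fin exprn_ge0.
  apply: lime_le; first by apply: is_cvg_nneseries => n _ _; rewrite lee_fin exprn_ge0.
  near=> n; rewrite sumEFin lee_fin.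
  rewrite -(@ler_pM2l _ (1 - q)) ?subr_gt0// mulfV ?subr_eq0 ?gt_eqF//.
  rewrite big_mkord -[X in (X - q)%R](expr1n _ n).
  have := subrXX 1%R q n; rewrite expr1n.
  under eq_bigr do rewrite expr1n mul1r.
  by move=> <-; rewrite gerBl exprn_ge0.
exists ((1 - q)^-1 + (1 - q)^-1)%R.
split; first by rewrite addr_gt0// invr_gt0 subr_gt0.
rewrite (esumID [set v : int | (0 <= v)%R]); last by move=> v _; rewrite lee_fin exprn_ge0.
have half (B : set int) (f : int -> nat) : set_inj B f ->
    (forall v, B v -> (f v <= absz v)%N) ->
    \esum_(v in setT `&` B) (q ^+ absz v)%:E <= ((1 - q)^-1)%:E.
  move=> fI fv; apply: le_trans nat_bound; rewrite setTI.
  rewrite -[leRHS]mul1e; apply: (@esum_transport _ _ _ _ f) => //.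
    by move=> n; rewrite lee_fin exprn_ge0.
  move=> v /fv vB; split=> //; rewrite mul1e lee_fin.
  by rewrite ler_wiXn2l// ltW.
rewrite EFinD; apply: leeD; apply: (half _ absz) => //.
- by move=> v w; rewrite !inE /=; lia.
- by move=> v w; rewrite !inE /=; lia.
Unshelve. all: by end_near. Qed.

End esum_tools.

(** * Energy *)

Definition upd (eta : config) (x : site) (v : int) : config :=
  fun y => if y == x then v else eta y.
Definition raise (D : {fset site}) (v : int) (eta : config) : config :=
  fun y => if y \in D then eta y + v else eta y.

Section energy.
Variable Lam : {fset site}.

Definition grad (eta : config) (b : bond) : int := `|eta (src b) - eta (tgt b)|.

Lemma energyE eta : sos_energy Lam eta = \sum_(b <- touching Lam) grad eta b.
Proof.
rewrite /sos_energy [RHS]fsbig_seq ?fset_uniq//.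
apply: (reindex_fsbig (fun b : bond => (src b, tgt b))); split.
- move=> [[a c] d] /=; rewrite in_touching /src /tgt /bonds /nearest_neighbours /=.
  by case: d => /=; move/orP => h; split=> //=; lia.
- move=> [[a c] d] [[a' c'] d'] _ _; rewrite /src /tgt /translate /=.
  case: d; case: d' => /= -[e1 e2 e3 e4].
  + by rewrite e1 e2.
  + by exfalso; lia.
  + by exfalso; lia.
  + by rewrite e1 e2.
- move=> [[a c] [a' c']]; rewrite /bonds /nearest_neighbours /= => -[h1 h2 h3 h4].
  have [e|e] : (a' = a /\ c' = c + 1) \/ (a' = a + 1 /\ c' = c) by lia.
    case: e h4 => -> -> h4; exists ((a, c), true) => //.
    by rewrite /= in_touching; apply/orP.
  case: e h4 => -> -> h4; exists ((a, c), false) => //.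
  by rewrite /= in_touching; apply/orP.
Qed.

Lemma energyN eta : sos_energy Lam (fun x => - eta x) = sos_energy Lam eta.
Proof.
rewrite !energyE; apply: eq_bigr => b _.
by rewrite /grad -opprD normrN.
Qed.

Lemma sum_bdry D : (D `<=` Lam)%fset ->
  \sum_(b <- touching Lam) (b \in bdry D)%:Z = #|` bdry D|%:Z.
Proof.
move=> /fsubsetP DLam; rewrite -(big_morph Posz PoszD (erefl _)); congr Posz.
rewrite -big_mkcond sum1_count -size_filter; apply/perm_size/uniq_perm.
- by rewrite filter_uniq ?fset_uniq.
- exact: fset_uniq.
- move=> b; rewrite mem_filter; case: (boolP (b \in bdry D)) => //= /bdry_touching.
  by rewrite !in_touching => /orP[] /DLam ->; rewrite ?orbT.
Qed.

(** Each height difference across the boundary drops by exactly one, and no other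
    difference changes. *)
Lemma energy_raise D eta : (D `<=` Lam)%fset ->
  (forall b, b \in bdry D ->
     if src b \in D then eta (src b) < eta (tgt b) else eta (tgt b) < eta (src b)) ->
  sos_energy Lam eta = sos_energy Lam (raise D 1 eta) + #|` bdry D|%:Z.
Proof.
move=> DLam Db; rewrite !energyE -(sum_bdry DLam) -big_split; apply: eq_bigr => b _ /=.
have := Db b; rewrite in_bdry /grad /raise.
by case: (src b \in D); case: (tgt b \in D) => //= h; lia.
Qed.

Lemma energy_lower D eta : (D `<=` Lam)%fset ->
  (forall b, b \in bdry D ->
     if src b \in D then eta (tgt b) < eta (src b) else eta (src b) < eta (tgt b)) ->
  sos_energy Lam eta = sos_energy Lam (raise D (- 1) eta) + #|` bdry D|%:Z.
Proof.
move=> DLam Db; rewrite -energyN (energy_raise DLam); last first.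
  by move=> b /Db; case: ifP => _; lia.
rewrite -[in RHS]energyN; congr (sos_energy Lam _ + _).
by apply/funext => x; rewrite /raise; case: ifP => _ //; lia.
Qed.

Lemma energy_raise_le eta :
  sos_energy Lam (raise Lam 1 eta) <= sos_energy Lam eta + #|` bdry Lam|%:Z.
Proof.
rewrite !energyE -(sum_bdry (fsubset_refl _)) -big_split; apply: ler_sum => b _ /=.
rewrite in_bdry /grad /raise.
by case: (src b \in Lam); case: (tgt b \in Lam) => //=; lia.
Qed.

Definition nbrs (x : site) : seq site :=
  [:: translate false x 1; translate false x (-1); translate true x 1; translate true x (-1)].

Definition local_energy (eta : config) (x : site) (t : int) : int :=
  \sum_(y <- nbrs x) `|t - eta y|.

Lemma energy_upd eta x t : x \in Lam ->
  sos_energy Lam (upd eta x t) + local_energy eta x (eta x) =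
  sos_energy Lam eta + local_energy eta x t.
Proof.
move=> xLam; rewrite !energyE.
pose s : seq bond := [:: (x, false); (translate false x (-1), false);
  (x, true); (translate true x (-1), true)].
have us : uniq s.
  by case: x @s {xLam} => a c; rewrite /translate /= !inE !xpair_eqE /=; lia.
have star F : \sum_(b <- touching Lam | b \in s) F b = \sum_(b <- s) F b :> int.
  rewrite -big_filter; apply/perm_big/uniq_perm => //.
    by rewrite filter_uniq ?fset_uniq.
  move=> b; rewrite mem_filter; case: (boolP (b \in s)) => //= bs.
  rewrite in_touching; move: bs; rewrite !inE.
  by move=> /or4P[] /eqP ->; rewrite /src /tgt /= ?translate_tgt xLam ?orbT.
rewrite (bigID (mem s)) /= [in RHS](bigID (mem s)) /= !star.
rewrite [in LHS](eq_bigr (grad eta)); last first.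
  move=> b bs; rewrite /grad /upd.
  case: eqP => [e|_].
    case/negP: bs; rewrite (_ : b = (x, b.2)); last by rewrite -e; case: (b).
    by rewrite /s; case: b.2; rewrite !inE !eqxx ?orbT.
  case: eqP => // e; case/negP: bs.
  rewrite (_ : b = (translate b.2 x (- 1), b.2)); last by rewrite -e tgt_translate; case: (b).
  by rewrite /s; case: b.2; rewrite !inE !eqxx ?orbT.
rewrite addrAC [RHS]addrAC; congr (_ + _).
rewrite /local_energy /nbrs !big_cons !big_nil /grad /upd /src /tgt /= !eqxx !translate_tgt.
have ne d v : v != 0 -> (translate d x v == x) = false.
  by move=> v0; apply/eqP => e; case: x d e {xLam s us star} => a c [] [] /=; lia.
rewrite !eqxx !ne //; lia.
Qed.

End energy.

(** * Weights of events *)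

Section weights.
Context {R : realType}.
Variables (beta : R) (Lam : {fset site}).
Hypothesis beta0 : 0 < beta.

Let W (U : set config) : \bar R := sos_weight_measure beta Lam (zero_boundary Lam) U.

Lemma ge0_weight eta : (0 <= (sos_weight beta Lam eta)%:E)%E.
Proof. by rewrite lee_fin expR_ge0. Qed.

Lemma energy_ge0 eta : 0 <= sos_energy Lam eta.
Proof. by rewrite energyE; apply: sumr_ge0 => b _; rewrite /grad. Qed.

(** A ray from [x] to the complement of [Lam] carries the height [eta x] down to
    zero, so the energy controls each height. *)
Lemma height_le_energy eta x : zero_boundary Lam eta -> `|eta x| <= sos_energy Lam eta.
Proof.
move=> eta0; have [xL|/eta0 ->] := boolP (x \in Lam); last by rewrite normr0 energy_ge0.
have [n [nL nE]] := exit_up true xL.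
pose f i : bond := (translate true x i%:Z, true).
have fin i : (i <= n)%N -> f i \in touching Lam.
  by move=> iln; rewrite in_touching /src /= nL.
have -> : `|eta x| = `|eta x - eta (tgt (f n))|.
  rewrite [eta (tgt (f n))]eta0 ?subr0//.
  by move: nE; rewrite in_bdry /src /= nL//; case: (_ \in Lam).
apply: (@le_trans _ _ (\sum_(i < n.+1) grad eta (f i))).
  elim: n {nL nE fin} => [|n IH].
    by rewrite big_ord1 /grad /src /f /= translate0.
  rewrite big_ord_recr /=; apply: (@le_trans _ _ (`|eta x - eta (tgt (f n))| +
     grad eta (f n.+1))); last by rewrite lerD2r.
  have -> : tgt (f n) = src (f n.+1).
    by rewrite /src /tgt /f /= translateD; congr translate; lia.
  by rewrite /grad; exact: ler_distD.
rewrite energyE -(big_mkord xpredT (fun i => grad eta (f i))) /index_iota subn0.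
rewrite -(big_map f xpredT (grad eta)).
set s := map f _.
have us : uniq s.
  by rewrite map_inj_uniq ?iota_uniq// => i j [] /addrI [].
have sL : {subset s <= touching Lam}.
  by move=> _ /mapP[i + ->]; rewrite mem_iota => /andP[_]; rewrite add0n ltnS => /fin.
rewrite [leRHS](bigID (mem s)) /= -[leLHS]addr0; apply: lerD; last first.
  by apply: sumr_ge0 => b _; rewrite /grad.
rewrite -[leRHS]big_filter le_eqVlt; apply/orP; left; apply/eqP/perm_big/uniq_perm => //.
  by rewrite filter_uniq ?fset_uniq.
by move=> b; rewrite mem_filter; case: (boolP (b \in s)) => //= /sL ->.
Qed.

(** Summing over the height of one site at a time leaves a power of a geometric
    series. *)
Lemma product_weight_finite (q : R) (S : {fset site}) : 0 <= q < 1 ->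
  exists c : R, (0 <= c) /\
  (\esum_(eta in zero_boundary S) (\prod_(x <- S) q ^+ `|eta x|)%:E <= c%:E)%E.
Proof.
move=> q01; have /andP[q0 q1] := q01.
have [c [c0 cP]] := int_geometric_bound q01.
have prod_ge0 (T : {fset site}) (eta : config) : (0 <= (\prod_(x <- T) q ^+ `|eta x|)%:E)%E.
  by rewrite lee_fin; apply: prodr_ge0 => x _; exact: exprn_ge0.
elim/finSet_rect: S => S IH.
have [->|/fset0Pn[x xS]] := eqVneq S fset0.
  exists 1; split => //.
  have -> : zero_boundary fset0 = [set (fun=> 0) : config].
    apply/seteqP; split=> [eta eta0|_ ->//].
    by apply/funext => y; rewrite eta0.
  by rewrite esum_set1 ?big_seq_fset0//=.
have [d [d0 dP]] := IH (S `\ x)%fset (fproperD1 xS).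
exists (d * c); split; first by rewrite mulr_ge0// ltW.
rewrite (esum_slice _ (fun eta : config => eta x)); last exact: prod_ge0.
apply: (@le_trans _ _ (d%:E * \esum_(v in [set: int]) (q ^+ `|v|)%:E)%E); last first.
  by rewrite EFinM lee_wpmul2l.
apply: le_esumZ => //; first by move=> v _; rewrite lee_fin exprn_ge0.
move=> v _; apply: (@le_trans _ _ ((q ^+ `|v|)%:E *
   \esum_(eta in zero_boundary (S `\ x)%fset) (\prod_(x <- (S `\ x)%fset) q ^+ `|eta x|)%:E)%E).
  apply: (@esum_transport _ _ _ _ _ (fun eta => upd eta x 0)) => //.
  - exact: exprn_ge0.
  - move=> eta eta'; rewrite !inE => -[_ e] [_ e'] h; apply/funext => y.
    have := congr1 (fun f => f y) h; rewrite /upd; case: eqP => // -> _.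
    by rewrite /= in e e'; rewrite e e'.
  - move=> eta [eta0 ev]; split.
      move=> y; rewrite !inE negb_and negbK /upd; case: eqP => //= _ yS.
      exact: eta0.
    rewrite -EFinM lee_fin (big_fsetD1 x)//= -ev ler_wpM2l ?exprn_ge0//.
    rewrite le_eqVlt; apply/orP; left; apply/eqP/eq_big_seq => y.
    by rewrite /upd !inE => /andP[/negbTE ->].
by rewrite muleC lee_wpmul2r// lee_fin exprn_ge0.
Qed.

(** The energy dominates the average over [Lam] of the absolute heights, so the
    weight is at most a product of geometric weights. *)
Lemma weight_measure_lty : (W setT < +oo)%E.
Proof.
have [L0|L0] := eqVneq Lam fset0.
  rewrite /W /sos_weight_measure setIT.
  have -> : zero_boundary Lam = [set (fun=> 0) : config].
    apply/seteqP; split=> [eta eta0|_ ->//].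
    by apply/funext => y; rewrite eta0 ?L0.
  by rewrite esum_set1 ?ge0_weight ?ltry.
have n0 : 0 < #|` Lam|%:R :> R by rewrite ltr0n cardfs_gt0.
set q := expR (- (beta / #|` Lam|%:R)).
have q01 : 0 <= q < 1.
  by rewrite /q expR_ge0 expR_lt1 oppr_lt0 divr_gt0.
have [c [c0 cP]] := product_weight_finite Lam q01.
apply: le_lt_trans (ltry c); apply: le_trans cP.
rewrite /W /sos_weight_measure setIT; apply: le_esum => eta eta0.
rewrite lee_fin /sos_weight.
have -> : \prod_(x <- Lam) q ^+ `|eta x| =
   expR (- (beta / #|` Lam|%:R) * (\sum_(x <- Lam) `|eta x|)%:~R).
  rewrite rmorph_sum /= mulr_sumr expR_sum; apply: eq_bigr => x _.
  by rewrite /q -expRM_natr -abszE -pmulrn.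
rewrite ler_expR !mulNr lerN2 -mulrA ler_pM2l// ler_pdivrMl//.
rewrite -[#|` Lam|%:R]/(#|` Lam|%:Z%:~R) -intrM ler_int.
apply: (@le_trans _ _ (\sum_(x <- Lam) sos_energy Lam eta)).
  by apply: ler_sum => x _; exact: height_le_energy.
by rewrite big_const_seq count_predT iter_addr_0 -mulr_natl natz.
Qed.

(** The unnormalised weight of an event, of which both probabilities are
    quotients. *)
Definition wt (U : set config) : R := fine (W U).

Lemma wtE U : (wt U)%:E = W U.
Proof.
rewrite /wt fineK// ge0_fin_numE ?measure_ge0//.
by apply: le_lt_trans weight_measure_lty; apply: le_measure; rewrite ?inE.
Qed.

Lemma wt_ge0 U : 0 <= wt U.
Proof. by rewrite -lee_fin wtE measure_ge0. Qed.

Lemma wt_gt0 U : U (fun=> 0) -> 0 < wt U.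
Proof.
move=> U0; rewrite -lte_fin wtE /W /sos_weight_measure.
apply: (@lt_le_trans _ _ (sos_weight beta Lam (fun=> 0))%:E).
  by rewrite lte_fin expR_gt0.
rewrite -(@esum_set1 R _ (fun=> 0) (fun eta => (sos_weight beta Lam eta)%:E)) ?ge0_weight//.
by apply: subset_esum => _ ->; split.
Qed.

Lemma wt_le A B : (forall eta, zero_boundary Lam eta -> A eta -> B eta) -> wt A <= wt B.
Proof.
move=> AB; rewrite -lee_fin !wtE /W; apply: subset_esum => eta [eta0 Aeta].
by split=> //; exact: AB.
Qed.

Lemma wtID A B : wt A = wt (A `&` B) + wt (A `&` ~` B).
Proof.
apply: EFin_inj; rewrite EFinD !wtE /W /sos_weight_measure !setIA.
by apply: esumID => eta _; exact: ge0_weight.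
Qed.

Lemma wtU A B : wt (A `|` B) <= wt A + wt B.
Proof.
rewrite (wtID _ A) lerD//; apply: wt_le => eta _; first by case.
by move=> [[]].
Qed.

Lemma wt_cover (I : eqType) (s : seq I) (F : I -> set config) A :
  (forall eta, zero_boundary Lam eta -> A eta -> exists2 i, i \in s & F i eta) ->
  wt A <= \sum_(i <- s) wt (F i).
Proof.
elim: s A => [|i s IH] A sA.
  rewrite big_nil; apply: (@le_trans _ _ (wt set0)).
    by apply: wt_le => eta eta0 /(sA _ eta0)[].
  by rewrite -lee_fin wtE /W measure0.
rewrite big_cons; apply: (@le_trans _ _ (wt (F i) + wt (A `&` ~` F i))).
  rewrite (wtID A (F i)) lerD//; apply: wt_le => eta _; by case.
rewrite lerD2l; apply: IH => eta eta0 [/(sA _ eta0)[j]].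
by rewrite inE => /orP[/eqP -> //|js Fj _]; exists j.
Qed.

Lemma wt_partition (I : eqType) (s : seq I) (g : config -> I) A : uniq s ->
  \sum_(i <- s) wt (A `&` [set eta | g eta = i]) =
  wt (A `&` [set eta | g eta \in s]).
Proof.
elim: s => [_|i s IH /= /andP[si us]].
  rewrite big_nil; apply: EFin_inj; rewrite wtE /W.
  by rewrite (_ : A `&` _ = set0) ?measure0//; apply/seteqP; split=> // eta [].
rewrite big_cons IH// [RHS](wtID _ [set eta | g eta = i]); congr (wt _ + wt _).
  apply/seteqP; split=> eta /= [Ae ge].
    by rewrite ge inE eqxx.
  by case: Ae.
apply/seteqP; split=> eta /= [Ae ge].
  by rewrite inE ge orbT; split=> // h; rewrite h (negbTE si) in ge.
by case: Ae => Ae; rewrite inE => /orP[/eqP|].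
Qed.

(** The form of all Peierls comparisons: an injection of configurations that
    changes the weight by a controlled factor. *)
Lemma wt_transport (f : config -> config) (c : R) A B : 0 <= c ->
  set_inj (zero_boundary Lam `&` A) f ->
  (forall eta, zero_boundary Lam eta -> A eta ->
     [/\ zero_boundary Lam (f eta), B (f eta) &
         sos_weight beta Lam eta <= c * sos_weight beta Lam (f eta)]) ->
  wt A <= c * wt B.
Proof.
move=> c0 fI fAB; rewrite -lee_fin EFinM !wtE /W /sos_weight_measure.
apply: (@esum_transport _ _ _ _ _ f) => //; first by move=> eta; exact: ge0_weight.
move=> eta [eta0 Ae]; have [f0 fB fw] := fAB _ eta0 Ae.
by rewrite -EFinM lee_fin.
Qed.

Lemma wt_slices (q c d : R) (g : config -> int) A : 0 <= q -> 0 <= c ->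
  (\esum_(v in [set: int]) (q ^+ `|v|)%:E <= d%:E)%E ->
  (forall v, wt (A `&` [set eta | g eta = v]) <= c * q ^+ `|v|) ->
  wt A <= c * d.
Proof.
move=> q0 c0 dP Av; rewrite -lee_fin wtE /W /sos_weight_measure.
rewrite (esum_slice _ g); last exact: ge0_weight.
apply: (@le_trans _ _ (c%:E * \esum_(v in [set: int]) (q ^+ `|v|)%:E)%E); last first.
  by rewrite EFinM lee_wpmul2l.
apply: le_esumZ => //; first by move=> v _; rewrite lee_fin exprn_ge0.
by move=> v _; rewrite -setIA -EFinM; have := Av v; rewrite -lee_fin wtE.
Qed.

Lemma mnormalizeE (mu : {measure set config -> \bar R}) P U (a b : R) :
  0 < a -> mu setT = a%:E -> mu U = b%:E -> mnormalize mu P U = (b / a)%:E.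
Proof. by move=> a0 ma mb; rewrite /mnormalize ma eqe gt_eqF//= mb. Qed.

Lemma sos_nofloorE U : sos_nofloor beta Lam U = (wt U / wt setT)%:E.
Proof. by apply: mnormalizeE; rewrite ?wt_gt0 ?wtE. Qed.

Definition nonneg_on : set config := [set eta | forall x, x \in Lam -> 0 <= eta x].

Lemma sos_floorE U : sos_floor beta Lam U = (wt (nonneg_on `&` U) / wt nonneg_on)%:E.
Proof.
have fE V : sos_weight_measure beta Lam (zero_boundary_floor Lam) V = W (nonneg_on `&` V).
  by rewrite /W /sos_weight_measure setIA.
apply: mnormalizeE; first by apply: wt_gt0 => x.
- by rewrite wtE -[in RHS](setIT nonneg_on); exact: fE.
- by rewrite wtE; exact: fE.
Qed.

Lemma weight_energyD eta eta' n : sos_energy Lam eta = sos_energy Lam eta' + n ->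
  sos_weight beta Lam eta = expR (- beta * n%:~R) * sos_weight beta Lam eta'.
Proof. by move=> e; rewrite /sos_weight e intrD mulrDr expRD mulrC. Qed.

End weights.

(** * The Peierls argument *)

Lemma bdry1E x b : (b \in bdry [fset x]%fset) = (b \in [:: (x, false);
  (translate false x (-1), false); (x, true); (translate true x (-1), true)]).
Proof.
case: b x => [[b1 b2] d] [x1 x2]; rewrite in_bdry !inE /src /tgt /translate /=.
by case: d; rewrite !xpair_eqE /=; lia.
Qed.

Lemma card_bdry1 x : #|` bdry [fset x]%fset| = 4%N.
Proof.
pose s : seq bond := [:: (x, false); (translate false x (-1), false);
  (x, true); (translate true x (-1), true)].
rewrite -[RHS]/(size s); apply/perm_size/uniq_perm; first exact: fset_uniq.
  by case: x @s => a c; rewrite /translate /= !inE !xpair_eqE /=; lia.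
by move=> b; rewrite bdry1E.
Qed.

Lemma raise_inj D v : injective (raise D v).
Proof.
move=> eta eta' /(congr1 (fun f => f _)) e; apply/funext => x.
by have := e x; rewrite /raise; case: ifP => _ //; lia.
Qed.

Lemma raise_zero_boundary (Lam D : {fset site}) v eta : (D `<=` Lam)%fset ->
  zero_boundary Lam eta -> zero_boundary Lam (raise D v eta).
Proof.
move=> /fsubsetP DL eta0 x xL; rewrite /raise; case: ifP => [/DL|_]; last exact: eta0.
by rewrite (negbTE xL).
Qed.

Section peierls.
Context {R : realType}.
Variables (beta : R) (Lam : {fset site}).
Hypothesis beta0 : 0 < beta.

Local Notation wt := (wt beta Lam).

(** When [D] is bounded by the set of heights at most [j], every boundary bond has
    its lower end inside, so that raising [D] gains one unit of energy on it. *)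
Lemma peierls_raise D (j : int) (A B : set config) : (D `<=` Lam)%fset ->
  (forall eta, zero_boundary Lam eta -> A eta ->
     bounded_by (fun y => eta y <= j) D /\ B (raise D 1 eta)) ->
  wt A <= expR (- beta) ^+ #|` bdry D| * wt B.
Proof.
move=> DL AB; apply: (wt_transport beta0 (f := raise D 1)).
- by rewrite exprn_ge0// expR_ge0.
- by move=> eta eta' _ _; exact: raise_inj.
move=> eta eta0 Ae; have [De Be] := AB _ eta0 Ae; split=> //.
  exact: raise_zero_boundary.
rewrite -expRM_natr (weight_energyD beta (energy_raise DL _)) ?lexx// => b /[dup] bD /De[]; move: bD; rewrite in_bdry.
by case: (src b \in D); case: (tgt b \in D) => //= _; lia.
Qed.

Lemma peierls_lower D (j : int) (A B : set config) : (D `<=` Lam)%fset ->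
  (forall eta, zero_boundary Lam eta -> A eta ->
     bounded_by (fun y => j <= eta y) D /\ B (raise D (-1) eta)) ->
  wt A <= expR (- beta) ^+ #|` bdry D| * wt B.
Proof.
move=> DL AB; apply: (wt_transport beta0 (f := raise D (-1))).
- by rewrite exprn_ge0// expR_ge0.
- by move=> eta eta' _ _; exact: raise_inj.
move=> eta eta0 Ae; have [De Be] := AB _ eta0 Ae; split=> //.
  exact: raise_zero_boundary.
rewrite -expRM_natr (weight_energyD beta (energy_lower DL _)) ?lexx// => b /[dup] bD /De[]; move: bD; rewrite in_bdry.
by case: (src b \in D); case: (tgt b \in D) => //= _; lia.
Qed.

(** [W k] is the weight of [x] having depth [k], and [V k] that of [x] and one of
    its neighbours having depth [k]. As [V] decays faster by a factor [8], it
    contributes only a convergent series to [W k / a ^+ k]. *)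
Lemma tail_recursion (a w : R) (W V : nat -> R) : 0 <= a -> 0 <= w ->
  W 0%N <= w -> V 0%N <= 4 * w ->
  (forall k, V k.+1 <= a / 8 * V k) ->
  (forall k, W k.+1 <= a * W k + V k.+1) ->
  forall k, W k <= 2 * a ^+ k * w.
Proof.
move=> a0 w0 W0 V0 Vrec Wrec.
have Vk k : V k <= 4 * ((a / 8) ^+ k * w).
  elim: k => [|k IH]; first by rewrite expr0 mul1r.
  apply: (le_trans (Vrec k)); rewrite exprS.
  rewrite [leRHS](_ : _ = a / 8 * (4 * ((a / 8) ^+ k * w))); last by ring.
  by rewrite ler_wpM2l// divr_ge0.
have e8 k : 0 <= (8^-1 : R) ^+ k by rewrite exprn_ge0.
(* the defect [8^-1 ^+ k] leaves room for the next term of the series *)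
suff Wk k : W k <= (2 - 8^-1 ^+ k) * (a ^+ k * w).
  move=> k; apply: (le_trans (Wk k)); rewrite -mulrA.
  by rewrite ler_wpM2r ?mulr_ge0 ?exprn_ge0// lerBlDr lerDl.
elim: k => [|k IH]; first by rewrite !expr0; lra.
apply: (le_trans (Wrec k)).
have h1 : a * W k <= (2 - 8^-1 ^+ k) * (a ^+ k.+1 * w).
  rewrite exprS [leRHS](_ : _ = a * ((2 - 8^-1 ^+ k) * (a ^+ k * w))); last by ring.
  by rewrite ler_wpM2l.
have := Vk k.+1; rewrite expr_div_n -exprVn => h2.
apply: (le_trans (lerD h1 h2)).
rewrite [X in _ + X <= _](_ : _ = 4 * 8^-1 ^+ k.+1 * (a ^+ k.+1 * w)); last by ring.
rewrite -mulrDl ler_wpM2r ?mulr_ge0 ?exprn_ge0// exprS.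
have := e8 k; lra.
Qed.

(** The contours around [x] other than its unit square, which has length [4],
    together weigh much less than this unit square. *)
Definition small_contours (r : R) : Prop :=
  forall x (C : {fset {fset site}}),
  (forall D, D \in C -> [/\ contour D, x \in D & (6 <= #|` bdry D|)%N]) ->
  \sum_(D <- C) r ^+ #|` bdry D| <= expR (- beta) ^+ 4 / 8.

Lemma nbrsP x z : z \in nbrs x -> exists d : bool, z = translate d x 1 \/ z = translate d x (-1).
Proof.
rewrite !inE => /or4P[] /eqP ->.
- by exists false; left.
- by exists false; right.
- by exists true; left.
- by exists true; right.
Qed.

Lemma nbrs_bdry6 D x z : z \in nbrs x -> x \in D -> z \in D -> (6 <= #|` bdry D|)%N.
Proof.
by move=> /nbrsP[d [->|->]] xD; apply: bdry_ge6 => //.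
Qed.

Lemma nbrs_bond x z : z \in nbrs x -> exists b, 
  (src b = x /\ tgt b = z) \/ (src b = z /\ tgt b = x).
Proof.
move=> /nbrsP[d [->|->]]; first by exists (x, d); left.
by exists (translate d x (-1), d); right; rewrite /src /tgt /= translate_tgt.
Qed.

Lemma bounded_by_nbr (P : pred site) D x z :
  bounded_by P D -> z \in nbrs x -> x \in D -> P z -> P x -> z \in D.
Proof.
move=> DP /nbrs_bond[b bxz] xD Pz Px; apply: contraT => zD.
have [|] := DP b.
  by rewrite in_bdry; case: bxz => -[-> ->]; rewrite xD (negbTE zD).
by case: bxz => -[-> ->]; rewrite Px Pz xD (negbTE zD).
Qed.

Lemma bounded_by_site (P : pred site) x :
  P x -> (forall z, z \in nbrs x -> ~~ P z) -> bounded_by P [fset x]%fset.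
Proof.
move=> Px nP b; rewrite in_bdry !in_fset1.
case: (src b =P x) => [e1|_]; case: (tgt b =P x) => [e2|_] //= _; rewrite ?e1 ?e2 Px.
- split=> //; apply/negbTE/nP.
  by rewrite -e1 /tgt /src /nbrs; case: b.2; rewrite !inE eqxx ?orbT.
- split=> //; apply/negbTE/nP.
  by rewrite -e2 /src -tgt_translate /nbrs; case: b.2; rewrite !inE eqxx ?orbT.
Qed.

(** Each unit of depth below [a] costs the four bonds of the unit square around
    [x]: either all neighbours are higher and raising [x] alone gains them, or
    some neighbour is as deep and a longer contour surrounds both sites. The
    hypothesis that [S] is stable under raising allows [S] to carry constraints
    from below; the one on [bdry Dom] keeps the contours inside [Dom]. *)
Lemma lower_tail (Dom : {fset site}) (S : set config) (a : int) x :
  small_contours (expR (- beta)) ->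
  (Dom `<=` Lam)%fset -> hole_free Dom -> x \in Dom ->
  (forall eta D, zero_boundary Lam eta -> S eta -> (D `<=` Dom)%fset ->
     S (raise D 1 eta)) ->
  (forall eta b, zero_boundary Lam eta -> S eta -> b \in bdry Dom ->
     a <= eta (src b) \/ a <= eta (tgt b)) ->
  forall k : nat,
  wt (S `&` [set eta | eta x <= a - k%:Z]) <= 2 * (expR (- beta) ^+ 4) ^+ k * wt S.
Proof.
move=> small DL Dh xD Sup Sb.
pose both (z : site) (k : nat) := S `&` [set eta : config | eta x <= a - k%:Z /\ eta z <= a - k%:Z].
have Dsub D : (D `<=` Dom)%fset -> (D `<=` Lam)%fset.
  by move=> h; exact: fsubset_trans DL.
apply: (@tail_recursion _ _ _ (fun k => \sum_(z <- nbrs x) wt (both z k))).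
- by rewrite exprn_ge0// expR_ge0.
- exact: wt_ge0.
- by apply: wt_le => // eta _ [].
- apply: (@le_trans _ _ (\sum_(z <- nbrs x) wt S)).
    by apply: ler_sum => z _; apply: wt_le => // eta _ [].
  by rewrite /nbrs !big_cons big_nil; lra.
- move=> k; rewrite mulr_sumr big_seq [leRHS]big_seq; apply: ler_sum => z zx.
  pose C := [fset D in fpowerset Dom | `[< contour D >] && (x \in D) && (z \in D)]%fset.
  have CP D : D \in C -> [/\ (D `<=` Dom)%fset, contour D, x \in D & z \in D].
    by rewrite !inE /= fpowersetE => /andP[-> /andP[/andP[/asboolP ? ?] ?]].
  pose F (D : {fset site}) := both z k.+1 `&`
    [set eta : config | bounded_by (fun y => eta y <= a - k.+1%:Z) D].
  apply: (@le_trans _ _ (\sum_(D <- C) wt (F D))).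
    apply: wt_cover => // eta eta0 [Se [ex ez]].
    pose P : pred site := fun y => eta y <= a - k.+1%:Z.
    have [|||D [DD xD' Dc DP]] := @exists_contour P Dom [fset y in Dom | P y]%fset x Dh.
    + by apply/fsubsetP => y; rewrite !inE => /andP[].
    + by rewrite !inE /= xD.
    + move=> b bD; have dom y : (y \in [fset y in Dom | P y]%fset) = (y \in Dom) && P y.
        by rewrite !inE.
      move: bD; rewrite in_bdry !dom.
      have := Sb _ b eta0 Se; rewrite in_bdry /P.
      case: (src b \in Dom); case: (tgt b \in Dom) => //= h h'; split=> //; lia.
    exists D => //.
    have zD : z \in D by exact: (bounded_by_nbr DP zx).
    rewrite !inE /= fpowersetE; apply/and3P; split=> //.
    by apply/andP; split=> //; apply/asboolP.
  apply: (@le_trans _ _ (\sum_(D <- C) expR (- beta) ^+ #|` bdry D| * wt (both z k))).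
    rewrite big_seq [leRHS]big_seq; apply: ler_sum => D /CP[DD Dc xD' zD].
    apply: (@peierls_raise _ (a - k.+1%:Z)); first exact: Dsub.
    move=> eta eta0 [[Se [ex ez]] DP]; split=> //; split; first exact: Sup.
    by rewrite /= /raise xD' zD; split; lia.
  rewrite -mulr_suml ler_wpM2r ?wt_ge0//; apply: (small x) => D /CP[_ Dc xD' zD].
  by split=> //; exact: (nbrs_bdry6 zx).
- move=> k; pose lone := S `&` [set eta : config | eta x <= a - k.+1%:Z /\
     forall z, z \in nbrs x -> a - k.+1%:Z < eta z].
  apply: (@le_trans _ _ (wt (lone `|` (S `&` [set eta | eta x <= a - k.+1%:Z /\
     exists2 z, z \in nbrs x & eta z <= a - k.+1%:Z])))).
    apply: wt_le => // eta _ [Se ex].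
    have [h|h] := pselect (exists2 z, z \in nbrs x & eta z <= a - k.+1%:Z); first by right.
    left; split=> //; split=> // z zx; rewrite ltNge; apply/negP => ez.
    by apply: h; exists z.
  apply: (le_trans (@wtU _ _ _ beta0 _ _)); apply: lerD; last first.
    by apply: wt_cover => // eta _ [Se [ex [z zx ez]]]; exists z.
  rewrite -(card_bdry1 x); apply: (@peierls_raise _ (a - k.+1%:Z)).
    by rewrite fsub1set; apply: (fsubsetP DL).
  move=> eta eta0 [Se [ex ez]]; split; last first.
    split; first by apply: Sup => //; rewrite fsub1set.
    by rewrite /= /raise inE eqxx /=; lia.
  by apply: bounded_by_site => // z /ez; rewrite -ltNge.
Qed.
End peierls.

(** * Upper tails without and with a floor *)

Section tails.
Context {R : realType}.
Variables (beta : R) (Lam : {fset site}).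
Hypothesis beta0 : 0 < beta.

Local Notation wt := (wt beta Lam).
(** The upper tail is the lower tail of [- eta]. *)
Lemma nofloor_upper_tail x k : small_contours beta (expR (- beta)) -> hole_free Lam ->
  x \in Lam ->
  wt [set eta | k%:Z <= eta x] <= 2 * (expR (- beta) ^+ 4) ^+ k * wt setT.
Proof.
move=> small Lh xL.
apply: (@le_trans _ _ (1 * wt (setT `&` [set eta : config | eta x <= 0 - k%:Z]))).
  apply: (wt_transport beta0 (f := fun eta y => - eta y)) => //.
    move=> eta eta' _ _ e; apply/funext => y.
    by have := congr1 (fun f => f y) e; lia.
  move=> eta eta0 /= ex; split.
  - by move=> y /eta0 ->; rewrite oppr0.
  - by split=> //=; lia.
  - by rewrite mul1r /sos_weight energyN.
rewrite mul1r; apply: (lower_tail beta0 small (fsubset_refl _)) => // eta b eta0 _.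
rewrite in_bdry; case: (boolP (src b \in Lam)) => [_|/eta0 -> _]; last by left.
by case: (boolP (tgt b \in Lam)) => // /eta0 -> _; right.
Qed.

(** The sites of [Y] are restored one after the other. A constraint [0 <= eta y]
    already imposed is stable under raising, so at each step the lower tail at
    depth [h] applies to the constrained set. *)
Lemma restore_floor (D : {fset site}) (S : set config) (h : nat) (Y : seq site) :
  small_contours beta (expR (- beta)) ->
  (D `<=` Lam)%fset -> hole_free D -> {subset Y <= D} ->
  2 * (expR (- beta) ^+ 4) ^+ h <= 1 ->
  (forall eta D', zero_boundary Lam eta -> S eta -> (D' `<=` D)%fset ->
     S (raise D' 1 eta)) ->
  (forall eta b, zero_boundary Lam eta -> S eta -> b \in bdry D ->
     h%:Z - 1 <= eta (src b) \/ h%:Z - 1 <= eta (tgt b)) ->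
  (1 - 2 * (expR (- beta) ^+ 4) ^+ h) ^+ size Y * wt S <=
  wt (S `&` [set eta : config | forall y, y \in Y -> 0 <= eta y]).
Proof.
move=> small DL Dh YD eps1 Sup Sb; set eps := 2 * _ in eps1 *.
elim: Y YD => [_|y Y IH YD].
  by rewrite expr0 mul1r; apply: wt_le.
have {}IH := IH (fun z zY => YD z (@mem_behead _ (y :: Y) z zY)).
set T := S `&` _ in IH.
have tail : wt (T `&` [set eta | eta y <= h%:Z - 1 - h%:Z]) <= eps * wt T.
  apply: (lower_tail beta0 small DL Dh); first by rewrite YD// mem_head.
  - move=> eta D' eta0 [Se Ye] D'D; split; first exact: Sup.
    by move=> z /Ye; rewrite /raise; case: ifP => _ //; lia.
  - by move=> eta b eta0 [Se _]; exact: Sb.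
have := @wtID _ _ Lam beta0 T [set eta | eta y <= h%:Z - 1 - h%:Z].
rewrite exprS -mulrA => e.
apply: (@le_trans _ _ ((1 - eps) * wt T)); first by rewrite ler_wpM2l// subr_ge0.
apply: (@le_trans _ _ (wt (T `&` ~` [set eta | eta y <= h%:Z - 1 - h%:Z]))).
  by rewrite mulrBl mul1r {1}e; lra.
apply: wt_le => // eta _ [[Se Ye] /negP ey]; split=> // z.
by rewrite inE => /orP[/eqP ->|/Ye//]; lia.
Qed.

Lemma one_sub_ge_exp (t : R) : 0 <= t <= 2^-1 -> expR (- (2 * t)) <= 1 - t.
Proof.
move=> /andP[t0 t1]; rewrite expRN.
have e := expR_ge1Dx (2 * t).
have pos : 0 < 1 + 2 * t by lra.
apply: (@le_trans _ _ (1 + 2 * t)^-1).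
  by rewrite lef_pV2 ?posrE ?expR_gt0.
rewrite -[leLHS]mul1r ler_pdivrMr//; nra.
Qed.

Lemma small_contours_le (r s : R) : 0 <= r -> r <= s ->
  small_contours beta s -> small_contours beta r.
Proof.
move=> r0 rs small x C CP; apply: le_trans (small x C CP).
by apply: ler_sum => D _; rewrite lerXn2r ?nnegrE // (le_trans r0).
Qed.
Lemma le_raise D (eta : config) y : eta y <= raise D 1 eta y.
Proof. by rewrite /raise; case: ifP => _; lia. Qed.

(** Lowering the interior of a contour of length [n] at a level [h > H] may push
    heights from [0] to [-1]. Such a site is a downward spike of depth [h], and
    the interior has at most [n L] sites; as [L] spikes of depth [H] together
    weigh at most one, restoring all of them costs at most [expR (4 n)]. The
    rate [beta - 4] left for contours is still large, and the recursion is that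
    of [lower_tail]. *)
Lemma floor_upper_tail (L H : nat) x : Lam = box L ->
  small_contours beta (expR (- (beta - 4))) -> 4 * expR (- beta) ^+ 4 <= 1 ->
  L%:R * (expR (- beta) ^+ 4) ^+ H <= 1 -> x \in Lam ->
  forall k : nat, wt (nonneg_on Lam `&` [set eta | H%:Z + k%:Z <= eta x]) <=
    2 * (expR (- beta) ^+ 4) ^+ k * wt (nonneg_on Lam).
Proof.
move=> LamE small a4 LH xL; have low1 (u v : int) : u <= v -> u - 1 <= v - 1 by rewrite lerD2r.
set a := expR (- beta) ^+ 4.
have a0 : 0 <= a by rewrite exprn_ge0// expR_ge0.
have a1 : a <= 1 by rewrite -/a in a4; lra.
have Lh : hole_free Lam by rewrite LamE; exact: box_hole_free.
have small0 : small_contours beta (expR (- beta)).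
  by apply: small_contours_le small; rewrite ?expR_ge0// ler_expR; lra.
pose both (z : site) (k : nat) := nonneg_on Lam `&`
  [set eta : config | H%:Z + k%:Z <= eta x /\ H%:Z + k%:Z <= eta z].
apply: (@tail_recursion _ _ _ (fun k => wt (nonneg_on Lam `&` [set eta | H%:Z + k%:Z <= eta x]))
   (fun k => \sum_(z <- nbrs x) wt (both z k))) => //.
- exact: wt_ge0.
- by apply: wt_le => // eta _ [].
- apply: (@le_trans _ _ (\sum_(z <- nbrs x) wt (nonneg_on Lam))).
    by apply: ler_sum => z _; apply: wt_le => // eta _ [].
  by rewrite /nbrs !big_cons big_nil; lra.
- move=> k; rewrite mulr_sumr big_seq [leRHS]big_seq; apply: ler_sum => z zx.
  pose C := [fset D in fpowerset Lam | `[< contour D >] && (x \in D) && (z \in D)]%fset.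
  have CP D : D \in C -> [/\ (D `<=` Lam)%fset, contour D, x \in D & z \in D].
    by rewrite !inE /= fpowersetE => /andP[-> /andP[/andP[/asboolP ? ?] ?]].
  pose h := (H + k).+1.
  have hE : H%:Z + k.+1%:Z = h%:Z by rewrite /h; lia.
  have hE' : H%:Z + k%:Z = h%:Z - 1 by rewrite /h; lia.
  pose F (D : {fset site}) := both z k.+1 `&`
    [set eta : config | bounded_by (fun y => h%:Z <= eta y) D].
  apply: (@le_trans _ _ (\sum_(D <- C) wt (F D))).
    apply: wt_cover => // eta eta0 [Fe [ex ez]].
    pose P : pred site := fun y => h%:Z <= eta y.
    have [|||D [DD xD Dc DP]] := @exists_contour P Lam [fset y in Lam | P y]%fset x Lh.
    + by apply/fsubsetP => y; rewrite !inE => /andP[].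
    + by rewrite !inE /= xL /P -hE.
    + move=> b bD; have dom y : (y \in [fset y in Lam | P y]%fset) = P y.
        rewrite !inE /=; case: (boolP (y \in Lam)) => //= /eta0; rewrite /P => ->.
        by apply/esym/negbTE; rewrite /h; lia.
      by rewrite !dom.
    exists D => //.
    have zD : z \in D by apply: (bounded_by_nbr DP zx) => //; rewrite /P -hE.
    rewrite !inE /= fpowersetE; apply/and3P; split=> //.
    by apply/andP; split=> //; apply/asboolP.
  apply: (@le_trans _ _ (\sum_(D <- C) expR (- (beta - 4)) ^+ #|` bdry D| * wt (both z k))).
    rewrite big_seq [leRHS]big_seq; apply: ler_sum => D /CP[DL [D0 Dl Dh] xD zD].
    pose B := [set eta : config | [/\ forall y, y \in Lam -> y \notin D -> 0 <= eta y,
      forall y, y \in D -> - 1 <= eta y,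
      forall b, b \in bdry D -> h%:Z - 1 <= eta (src b) \/ h%:Z - 1 <= eta (tgt b),
      h%:Z - 1 <= eta x & h%:Z - 1 <= eta z]].
    apply: (@le_trans _ _ (expR (- beta) ^+ #|` bdry D| * wt B)).
      apply: (@peierls_lower _ _ _ beta0 _ h%:Z) => // eta eta0 [[Fe [ex ez]] DP]; split=> //.
      split=> [y yL yD|y yD|b bD||]; rewrite /raise.
      + by rewrite (negbTE yD); exact: Fe.
      + by rewrite yD -[leLHS]add0r lerD2r; apply: Fe; exact: (fsubsetP DL).
      + have [] := DP _ bD; move: bD; rewrite in_bdry.
        case: (src b \in D); case: (tgt b \in D) => // _ e1 e2.
          by left; exact: low1.
        by right; exact: low1.
      + by rewrite xD; apply: low1; rewrite -hE.
      + by rewrite zD; apply: low1; rewrite -hE.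
    have aH : a ^+ h <= a ^+ H by rewrite ler_wiXn2l// /h ltnW// ltnS leq_addr.
    have ah : a ^+ h <= a by rewrite -[leRHS]expr1 ler_wiXn2l.
    have ah0 : 0 <= a ^+ h by rewrite exprn_ge0.
    have restore : (1 - 2 * a ^+ h) ^+ size D * wt B <= wt (both z k).
      apply: le_trans (restore_floor (Y := D) small0 DL Dh _ _ _ _) _ => //.
      + by rewrite -/a; rewrite -/a in a4; lra.
      + move=> eta D' eta0 [B1 B2 B3 B4 B5] /fsubsetP D'D.
        split=> [y yL yD|y yD|b bD||].
        * exact: le_trans (B1 _ yL yD) (le_raise _ _ _).
        * exact: le_trans (B2 _ yD) (le_raise _ _ _).
        * by case: (B3 _ bD) => e; [left|right]; exact: le_trans e (le_raise _ _ _).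
        * exact: le_trans B4 (le_raise _ _ _).
        * exact: le_trans B5 (le_raise _ _ _).
      + by move=> eta b eta0 [_ _ B3 _ _]; exact: B3.
      apply: wt_le => // eta eta0 [[B1 _ _ B4 B5] Dp]; split; last by rewrite /= hE'.
      move=> y yL; case: (boolP (y \in D)) => [/Dp//|]; exact: B1.
    apply: le_trans (ler_wpM2l _ restore); last by rewrite exprn_ge0 ?expR_ge0.
    rewrite mulrA ler_wpM2r ?wt_ge0//.
    have -> : - (beta - 4) = - beta + 4 by lra.
    rewrite expRD exprMn -mulrA -[leLHS]mulr1 ler_wpM2l ?exprn_ge0 ?expR_ge0//.
    have t1 : expR (- (2 * (2 * a ^+ h))) <= 1 - 2 * a ^+ h.
      by apply: one_sub_ge_exp; apply/andP; split; rewrite -/a in a4; lra.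
    have := lerXn2r (size D) _ _ t1; rewrite !nnegrE expR_ge0 => /(_ isT).
    have -> : (0 <= 1 - 2 * a ^+ h) = true by rewrite -/a in a4; lra.
    move=> /(_ isT) t2.
    apply: (@le_trans _ _ (expR 4 ^+ #|` bdry D| * expR (- (2 * (2 * a ^+ h))) ^+ size D));
      last by rewrite ler_wpM2l ?exprn_ge0 ?expR_ge0.
    rewrite -!expRM_natr -expRD -[leLHS]expR0 ler_expR.
    have cardD : (#|` D| <= L * #|` bdry D|)%N.
      by apply: card_le_bdry => y /(fsubsetP DL); rewrite LamE in_box => /andP[_ yb].
    have cardR : (size D)%:R <= L%:R * #|` bdry D|%:R :> R.
      by rewrite -natrM ler_nat; exact: cardD.
    have n0 : 0 <= #|` bdry D|%:R :> R by [].
    have La : L%:R * a ^+ h <= 1 by apply: le_trans LH; rewrite ler_wpM2l.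
    have aD : a ^+ h * (size D)%:R <= #|` bdry D|%:R.
      apply: (@le_trans _ _ (a ^+ h * (L%:R * #|` bdry D|%:R))); first by rewrite ler_wpM2l.
      by rewrite mulrA [_ * L%:R]mulrC -[leRHS]mul1r ler_wpM2r.
    rewrite [leRHS](_ : _ = 4 * (#|` bdry D|%:R - a ^+ h * (size D)%:R)); last by ring.
    by rewrite mulr_ge0// subr_ge0.
  rewrite -mulr_suml ler_wpM2r ?wt_ge0//; apply: (small x) => D /CP[_ Dc xD zD].
  by split=> //; exact: (nbrs_bdry6 zx).
- move=> k; pose h := (H + k).+1.
  have hE : H%:Z + k.+1%:Z = h%:Z by rewrite /h; lia.
  have hE' : H%:Z + k%:Z = h%:Z - 1 by rewrite /h; lia.
  pose lone := nonneg_on Lam `&` [set eta : config | h%:Z <= eta x /\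
     forall z, z \in nbrs x -> eta z < h%:Z].
  apply: (@le_trans _ _ (wt (lone `|` (nonneg_on Lam `&` [set eta | h%:Z <= eta x /\
     exists2 z, z \in nbrs x & h%:Z <= eta z])))).
    apply: wt_le => // eta _ [Fe]; rewrite /= hE => ex.
    have [g|g] := pselect (exists2 z, z \in nbrs x & h%:Z <= eta z); first by right.
    left; split=> //; split=> // z zx; rewrite ltNge; apply/negP => ez.
    by apply: g; exists z.
  apply: (le_trans (@wtU _ _ _ beta0 _ _)); apply: lerD; last first.
    apply: wt_cover => // eta _ [Fe [ex [z zx ez]]]; exists z => //.
    by split=> //=; rewrite hE.
  rewrite /a -(card_bdry1 x); apply: (@peierls_lower _ _ _ beta0 _ h%:Z).
    by rewrite fsub1set.
  move=> eta eta0 [Fe [ex ez]]; split; last first.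
    split; last by rewrite /= /raise inE eqxx hE'; lia.
    move=> y yL; rewrite /raise inE; case: eqP => [->|_]; last exact: Fe.
    by move: ex; rewrite /h; lia.
  by apply: bounded_by_site => // z /ez; rewrite -ltNge.
Qed.

End tails.

(** Each bond of a contour of length at least [6] carries [beta - 4]; six of them
    give a margin of [2 beta - 24] over the exponent [4 beta] of the unit square,
    which beats the entropy of contours. *)
Lemma large_beta (R : realType) : exists2 b0 : R, 0 < b0 & forall beta, b0 <= beta ->
  small_contours beta (expR (- (beta - 4))) /\ 4 * expR (- beta) ^+ 4 <= 1.
Proof.
have [K K18] : exists K : nat, (2 * 18 ^ 2 <= K)%N by exists (2 * 18 ^ 2)%N.
have K1 : 1 <= K%:R :> R by rewrite ler1n; apply: leq_trans K18.
pose c : R := 16 * K%:R ^+ 6.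
have K6 : K%:R <= K%:R ^+ 6 :> R by rewrite ler_eXnr.
have c1 : 1 <= c by rewrite /c; lra.
exists (12 + ln c); first by rewrite ltr_wpDr// ln_ge0.
move=> beta betac; have cb : c <= expR (beta - 12).
  rewrite -[leLHS]lnK ?posrE; last by lra.
  by rewrite ler_expR; lra.
have b12 : 12 <= beta by have := ln_ge0 c1; lra.
set r := expR _; have r0 : 0 < r by exact: expR_gt0.
have rE : r * expR (beta - 4) = 1 by rewrite /r -expRD addNr expR0.
have c4 : c <= expR (beta - 4) by apply: le_trans cb _; rewrite ler_expR; lra.
split; last first.
  rewrite -expRM_natr.
  have -> : - beta * 4%:R = - (4 * beta) by ring.
  have : 1 + 4 * beta <= expR (4 * beta) by exact: expR_ge1Dx.
  rewrite expRN => e4; rewrite ler_pdivrMr ?expR_gt0//; lra.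
move=> x C CP; apply: (le_trans (contour_sum K18 (ltW r0) _ CP)).
  rewrite -(ler_pM2r (expR_gt0 (beta - 4))) -mulrA rE mulr1.
  rewrite /c in c4; lra.
rewrite exprMn; apply: (@le_trans _ _ (c * r ^+ 6 / 8)); first by rewrite /c; lra.
rewrite ler_pM2r ?invr_gt0//.
apply: (@le_trans _ _ (expR (beta - 12) * r ^+ 6)); first by rewrite ler_wpM2r// exprn_ge0// ltW.
rewrite /r -!expRM_natr -expRD ler_expR; lra.
Qed.

(** * Resampling sites *)

Section fluctuations.
Context {R : realType}.
Variables (beta : R) (Lam : {fset site}) (d : R).
Hypothesis beta0 : 0 < beta.
Hypothesis d0 : 0 < d.
Hypothesis dP : (\esum_(v in [set: int]) (expR (- beta) ^+ `|v|)%:E <= d%:E)%E.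

Local Notation wt := (wt beta Lam).

Lemma nbr_neq x z : z \in nbrs x -> (z == x) = false.
Proof.
case: x z => a c [a' c']; rewrite !inE /translate /= !xpair_eqE.
by move=> /or4P[] /andP[/eqP -> /eqP ->]; lia.
Qed.

(** Resampling the height at [x]: its value relative to a fixed neighbour costs at
    least its absolute value, so that the sum over the old heights is at most
    [d], while [m] bounds the energy of the four bonds at the new height. *)
Lemma single_site (U V : set config) x (t : int) (m : R) : x \in Lam ->
  (forall eta, zero_boundary Lam eta -> U eta ->
     V (upd eta x t) /\ (local_energy eta x t)%:~R <= m) ->
  wt U <= d * expR (beta * m) * wt V.
Proof.
move=> xL UV; pose y := translate false x 1.
have yx : y \in nbrs x by rewrite inE eqxx.
have updy eta : upd eta x t y = eta y by rewrite /upd nbr_neq.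
rewrite -mulrA mulrC.
apply: (wt_slices beta0 (q := expR (- beta)) (g := fun eta => eta x - eta y)) => //.
- by rewrite mulr_ge0 ?expR_ge0 ?wt_ge0.
move=> v; rewrite mulrAC.
apply: (wt_transport beta0 (f := fun eta => upd eta x t)).
- by rewrite mulr_ge0 ?exprn_ge0 ?expR_ge0.
- move=> eta eta'; rewrite !inE => -[_ [_ /= e]] [_ [_ /= e']] h.
  have hz z : upd eta x t z = upd eta' x t z by rewrite h.
  have := hz y; rewrite !updy => hy.
  apply/funext => z; have := hz z; rewrite /upd; case: eqP => // -> _.
  by rewrite -(subrK (eta y) (eta x)) e hy -e' subrK.
move=> eta eta0 [Ue /= ev]; have [Vu um] := UV _ eta0 Ue; split=> //.
  by move=> z zL; rewrite /upd; case: eqP => [e|_]; [rewrite -e (negbTE zL) in xL|exact: eta0].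
have vloc : `|v| <= local_energy eta x (eta x).
  rewrite /local_energy /nbrs big_cons -/y ev lerDl.
  by apply: sumr_ge0.
have := energy_upd eta t xL; set E := sos_energy _ _; set E' := sos_energy _ _.
set l := local_energy _ _ t in um *; set l' := local_energy _ _ _ in vloc * => e.
have le_ : `|v| - l + E <= E' by lia.
rewrite /sos_weight -!/E -!/E' -expRM_natr -!expRD ler_expR.
have {}le_ : (`|v|%N)%:R - m + E%:~R <= E'%:~R :> R.
  apply: (@le_trans _ _ (`|v| - l + E)%:~R); last by rewrite ler_int.
  by rewrite intrD intrB -abszE -pmulrn lerD2r lerD2l lerN2.
have := ler_wpM2l (ltW beta0) le_; lra.
Qed.

(** Independent trials: given the other heights, each site of [xs] sits at [k]
    with probability at least [(d * expR (beta * m))^-1], by [single_site]. *)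
Lemma trials (U : set config) (xs : seq site) (k : int) (m : R) :
  uniq xs -> {subset xs <= Lam} ->
  (forall eta x, zero_boundary Lam eta -> U eta -> x \in xs ->
     U (upd eta x k) /\ (local_energy eta x k)%:~R <= m) ->
  wt (U `&` [set eta : config | forall x, x \in xs -> eta x < k]) <=
  expR (- (d * expR (beta * m))^-1) ^+ size xs * wt U.
Proof.
elim: xs => [_ _ _|x xs IH /= /andP[xxs uxs] xsL Uk].
  by rewrite expr0 mul1r; apply: wt_le => // eta _ [].
have {}IH := IH uxs (fun z zs => xsL z (@mem_behead _ (x :: xs) z zs))
  (fun eta z e0 Ue zs => Uk eta z e0 Ue (@mem_behead _ (x :: xs) z zs)).
set T := U `&` _ in IH.
have xL : x \in Lam by apply: xsL; rewrite mem_head.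
set c := d * expR (beta * m) in IH *.
have c0 : 0 < c by rewrite mulr_gt0 ?expR_gt0.
have site : wt T <= c * wt (T `&` [set eta | eta x = k]).
  apply: (single_site (t := k) (m := m) xL) => eta eta0 [Ue Te].
  have [Uk1 Uk2] := Uk _ _ eta0 Ue (mem_head x xs); split=> //; split; last first.
    by rewrite /= /upd eqxx.
  split=> // z zs; rewrite /upd; case: eqP => [e|_]; last exact: Te.
  by rewrite -e zs in xxs.
apply: (@le_trans _ _ (expR (- c^-1) * wt T)); last first.
  by rewrite exprS -mulrA ler_wpM2l ?expR_ge0.
apply: (@le_trans _ _ ((1 - c^-1) * wt T)); last first.
  by rewrite ler_wpM2r ?wt_ge0// expR_ge1Dx.
have split_T := @wtID _ _ Lam beta0 T [set eta | eta x = k].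
apply: (@le_trans _ _ (wt (T `&` ~` [set eta | eta x = k]))).
  apply: wt_le => // eta _ [Ue lt]; split.
    by split=> // z zs; apply: lt; rewrite inE zs orbT.
  by move=> /= e; have := lt x (mem_head _ _); rewrite e ltxx.
rewrite mulrBl mul1r {1}split_T.
move: site; rewrite -ler_pdivrMl// => site.
by rewrite addrAC -subr_ge0; lra.
Qed.

(** A comparison for each value of a random subset adds up to a comparison for
    the event that this subset has at least [N] elements. *)
Lemma wt_random_subset (G G' : config -> {fset site}) (E : {fset site}) (A B : set config)
    (N : nat) (M c : R) :
  (forall eta, (G eta `<=` E)%fset) -> (forall eta, (G' eta `<=` E)%fset) ->
  0 <= M -> 0 <= c <= 1 ->
  (forall G0, (G0 `<=` E)%fset -> wt (A `&` [set eta | G eta = G0]) <=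
     M * c ^+ #|` G0| * wt (B `&` [set eta | G' eta = G0])) ->
  wt (A `&` [set eta | (N <= #|` G eta|)%N]) <= M * c ^+ N * wt B.
Proof.
move=> GE GE' M0 /andP[c0 c1] AB.
have part V (g : config -> {fset site}) : (forall eta, (g eta `<=` E)%fset) ->
    wt V = \sum_(G0 <- fpowerset E) wt (V `&` [set eta | g eta = G0]).
  move=> gE; rewrite wt_partition ?fset_uniq//; congr (wt _).
  apply/seteqP; split=> [eta Ve|eta []//]; split=> //=.
  by rewrite fpowersetE.
rewrite (part _ G GE) [wt B](part _ G' GE') mulr_sumr big_seq [leRHS]big_seq.
apply: ler_sum => G0; rewrite fpowersetE => G0E.
have [NG|GN] := leqP N #|` G0|; last first.
  apply: (@le_trans _ _ (wt set0)).
    by apply: wt_le => // eta _ [[_ /= NG] /= e]; move: NG; rewrite e leqNgt GN.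
  apply: (@le_trans _ _ 0); last by rewrite !mulr_ge0 ?exprn_ge0 ?wt_ge0.
  by rewrite -(mul0r (wt setT)) (wt_transport beta0 (f := id)).
apply: (@le_trans _ _ (wt (A `&` [set eta | G eta = G0]))).
  by apply: wt_le => // eta _ [[]].
apply: (le_trans (AB _ G0E)); rewrite ler_wpM2r ?wt_ge0// ler_wpM2l//.
exact: ler_wiXn2l.
Qed.


End fluctuations.

(** * Lower bounds for the maximum *)

(** No two of these sites are neighbours, so their heights are independent given
    the others. *)
Definition even_site (x : site) : bool := ~~ odd (absz x.1) && ~~ odd (absz x.2).

Definition evens (D : {fset site}) : {fset site} := [fset x in D | even_site x]%fset.

Lemma evens_sub D : (evens D `<=` D)%fset.
Proof. by apply/fsubsetP => x; rewrite !inE => /andP[]. Qed.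

Lemma even_nbr x z : even_site x -> z \in nbrs x -> ~~ even_site z.
Proof.
case: x z => a c [a' c']; rewrite !inE /translate /= !xpair_eqE /even_site /=.
by move=> /andP[oa oc] /or4P[] /andP[/eqP -> /eqP ->]; lia.
Qed.

Definition nbr_sum (eta : config) (x : site) : int := \sum_(y <- nbrs x) eta y.

Lemma nbr_sum_upd eta x z v : even_site x -> even_site z ->
  nbr_sum (upd eta x v) z = nbr_sum eta z.
Proof.
move=> ex ez; rewrite /nbr_sum big_seq [RHS]big_seq; apply: eq_bigr => y yz.
by rewrite /upd; case: eqP => // e; have := even_nbr ez yz; rewrite e ex.
Qed.

Lemma nbrs4 (V : zmodType) (c : V) x : \sum_(y <- nbrs x) c = c *+ 4.
Proof. by rewrite big_const_seq iter_addr_0. Qed.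

Section lower_bounds.
Context {R : realType}.
Variables (beta : R) (Lam : {fset site}) (d : R).
Hypothesis beta0 : 0 < beta.
Hypothesis d0 : 0 < d.
Hypothesis dP : (\esum_(v in [set: int]) (expR (- beta) ^+ `|v|)%:E <= d%:E)%E.

Local Notation wt := (wt beta Lam).

(** If the neighbours of [x] stay below [k], the energy of its four bonds at height
    [k] is exactly [4 * k] minus the sum of their heights; if the latter is at
    least [4 * h], this bounds from below the chance that [x] reaches [k],
    whatever the other even sites do. *)
Lemma max_ge (S : set config) (k : int) (h : R) (N : nat) : 0 < k ->
  (forall eta x, zero_boundary Lam eta -> S eta -> S (upd eta x k)) ->
  wt (S `&` [set eta : config | forall x, x \in Lam -> eta x < k] `&`
    [set eta | (N <= #|` [fset x in evens Lam | (4 * h <= (nbr_sum eta x)%:~R)%R]%fset|)%N]) <=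
  expR (- (d * expR (beta * (4 * k%:~R - 4 * h)))^-1) ^+ N * wt S.
Proof.
move=> k0 Sk; set p := (d * _)^-1.
have p0 : 0 < p by rewrite invr_gt0 mulr_gt0 ?expR_gt0.
pose good (eta : config) x := (4 * h <= (nbr_sum eta x)%:~R) &&
  all (fun y => eta y < k) (nbrs x).
pose G eta := [fset x in evens Lam | good eta x]%fset.
have GP eta x : (x \in G eta) = (x \in evens Lam) && good eta x by rewrite !inE.
have Gupd eta x v : even_site x -> G (upd eta x v) = G eta.
  move=> ex; apply/fsetP => z; rewrite !GP; case: (boolP (z \in evens Lam)) => //=.
  rewrite !inE => /andP[_ ez]; rewrite /good nbr_sum_upd//; congr (_ && _).
  apply: eq_in_all => y yz; rewrite /upd; case: eqP => // e.
  by have := even_nbr ez yz; rewrite e ex.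
apply: (@le_trans _ _ (wt ((S `&` [set eta : config | forall x, x \in evens Lam -> eta x < k])
    `&` [set eta | (N <= #|` G eta|)%N]))).
  apply: wt_le => // eta eta0 [[Se lt] NG]; split.
    by split=> // x /(fsubsetP (evens_sub Lam)); exact: lt.
  apply: leq_trans NG _; apply: fsubset_leq_card; apply/fsubsetP => x.
  rewrite GP !inE /= => /andP[/andP[-> ->] hx] /=; rewrite /good hx andTb.
  by apply/allP => y _; have [/lt//|/eta0 ->] := boolP (y \in Lam).
have GE eta : (G eta `<=` evens Lam)%fset by apply/fsubsetP => x; rewrite GP => /andP[].
rewrite -[X in X * _]mul1r.
apply: (wt_random_subset beta0 (E := evens Lam) (G' := G) (B := S)) => //.
  by rewrite expR_ge0 /= -[leRHS]expR0 ler_expR oppr_le0 ltW.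
move=> G0 G0E; rewrite mul1r.
have G0P x : x \in G0 -> x \in Lam /\ even_site x.
  by move=> /(fsubsetP G0E); rewrite !inE => /andP[].
apply: (@le_trans _ _ (wt ((S `&` [set eta | G eta = G0]) `&`
    [set eta : config | forall x, x \in (G0 : seq site) -> eta x < k]))).
  apply: wt_le => // eta _ [[Se lt] Ge]; split=> // x xG; apply: lt.
  exact: (fsubsetP G0E).
apply: (trials beta0 d0 dP (m := 4 * k%:~R - 4 * h)); first exact: fset_uniq.
  by move=> x /G0P[].
move=> eta x eta0 [Se /= Ge] xG; have [xL ex] := G0P _ xG.
split; first by split; [exact: Sk|rewrite /= Gupd].
have : x \in G eta by rewrite Ge.
rewrite GP => /andP[_ /andP[hx /allP ltx]].
have -> : local_energy eta x k = k *+ 4 - nbr_sum eta x.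
  rewrite /local_energy /nbr_sum -(nbrs4 k x) -sumrB big_seq [RHS]big_seq.
  by apply: eq_bigr => y yx; rewrite ger0_norm// subr_ge0 ltW// ltx.
by rewrite intrB rmorphMn /= -mulr_natl lerD2l lerN2.
Qed.

(** Entropic repulsion: raising the whole box by one costs its perimeter, and
    then each even site whose neighbours are low may independently be put back
    to height zero, at a cost bounded by the heights of those neighbours. *)
Lemma few_low_sites (h : R) (N : nat) :
  let q := (d * expR (beta * (4 * h + 4)))^-1 in q <= 1 ->
  wt (nonneg_on Lam `&`
    [set eta | (N <= #|` [fset x in evens Lam | ((nbr_sum eta x)%:~R <= 4 * h)%R]%fset|)%N]) <=
  expR (beta * #|` bdry Lam|%:R) * expR (- (q / 2)) ^+ N * wt (nonneg_on Lam).
Proof.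
move=> q q1.
have q0 : 0 < q by rewrite invr_gt0 mulr_gt0 ?expR_gt0.
pose G eta := [fset x in evens Lam | ((nbr_sum eta x)%:~R <= 4 * h)%R]%fset.
have GP eta x : (x \in G eta) = (x \in evens Lam) && ((nbr_sum eta x)%:~R <= 4 * h).
  by rewrite !inE.
(* lifted configurations, where the sites of [xs] may have come back to zero *)
pose A (G0 : {fset site}) (xs : seq site) := [set eta : config |
  [/\ forall y, y \in Lam -> y \notin xs -> 1 <= eta y,
      forall y, y \in xs -> 0 <= eta y & G (raise Lam (-1) eta) = G0]].
have shift G0 : wt (nonneg_on Lam `&` [set eta | G eta = G0]) <=
    expR (beta * #|` bdry Lam|%:R) * wt (A G0 [::]).
  apply: (wt_transport beta0 (f := raise Lam 1)); first exact: expR_ge0.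
    by move=> eta eta' _ _; exact: raise_inj.
  move=> eta eta0 [Fe /= Ge]; split.
  - exact: raise_zero_boundary.
  - split=> // [y yL _|]; first by rewrite /raise yL; have := Fe _ yL; lia.
    rewrite -Ge; congr G; apply/funext => y; rewrite /raise.
    by case: (y \in Lam) => //; rewrite addrK.
  - rewrite /sos_weight -expRD ler_expR.
    have := energy_raise_le Lam eta; rewrite -(ler_int R) intrD => e.
    have := ler_wpM2l (ltW beta0) e; rewrite -pmulrn; lra.
have reopen G0 xs : uniq xs -> (forall x, x \in xs -> x \in G0) -> (G0 `<=` evens Lam)%fset ->
    wt (A G0 [::]) <= expR (- (q / 2)) ^+ size xs * wt (A G0 xs).
  move=> + + G0E; elim: xs => [_ _|x xs IH /= /andP[xxs uxs] xsG].
    by rewrite expr0 mul1r.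
  have {}IH := IH uxs (fun z zs => xsG z (@mem_behead _ (x :: xs) z zs)).
  apply: (le_trans IH); rewrite exprSr -mulrA ler_wpM2l ?exprn_ge0 ?expR_ge0//.
  have xG : x \in G0 by apply: xsG; rewrite mem_head.
  have := fsubsetP G0E _ xG; rewrite !inE => /andP[xL ex].
  pose V := A G0 (x :: xs) `&` [set eta | eta x = 0].
  have site : wt (A G0 xs) <= q^-1 * wt V.
    rewrite /q invrK; apply: (single_site beta0 d0 dP (t := 0) xL) => eta eta0 [A1 A2 A3].
    split; [split; last by rewrite /= /upd eqxx|].
      split.
      + move=> y yL; rewrite inE negb_or => /andP[yx yxs].
        by rewrite /upd (negbTE yx); exact: A1.
      + move=> y; rewrite inE /upd; case: eqP => //= _ yxs; exact: A2.
      + rewrite -A3; apply/fsetP => z; rewrite !GP.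
        case: (boolP (z \in evens Lam)) => //=; rewrite !inE => /andP[_ ez].
        congr (_%:~R <= _); rewrite /nbr_sum big_seq [RHS]big_seq; apply: eq_bigr => y yz.
        rewrite /raise /upd; case: eqP => // e.
        by have := even_nbr ez yz; rewrite e ex.
    have : x \in G (raise Lam (-1) eta) by rewrite A3.
    rewrite GP => /andP[_ hx].
    apply: (@le_trans _ _ ((nbr_sum (raise Lam (-1) eta) x)%:~R + 4)); last by rewrite lerD2r.
    rewrite -[4]/(4%:Z%:~R) -intrD ler_int /local_energy /nbr_sum.
    apply: (@le_trans _ _ (\sum_(y <- nbrs x) (raise Lam (-1) eta y + 1))); last first.
      by rewrite big_split /= nbrs4.
    apply: ler_sum => y _.
    rewrite sub0r normrN /raise.
    have [yL|/eta0 ->] := boolP (y \in Lam); last by rewrite normr0.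
    have y0 : 0 <= eta y.
      by have [/A2//|/(A1 _ yL)] := boolP (y \in xs); exact: le_trans.
    by rewrite ger0_norm// subrK.
  have AV : wt (A G0 xs) + wt V <= wt (A G0 (x :: xs)).
    rewrite (@wtID _ _ Lam beta0 (A G0 (x :: xs)) [set eta | eta x = 0]) addrC lerD2l.
    apply: wt_le => // eta eta0 [A1 A2 A3]; split.
      split=> // y; first by move=> yL; rewrite inE negb_or => /andP[_]; exact: A1.
      by rewrite inE => /orP[/eqP ->|]; [exact: le_trans (A1 _ xL xxs)|exact: A2].
    by move=> /= e; have := A1 _ xL xxs; rewrite e.
  have {}site : q * wt (A G0 xs) <= wt V by rewrite -ler_pdivlMl.
  have half : (1 + q) * wt (A G0 xs) <= wt (A G0 (x :: xs)) by rewrite mulrDl mul1r; lra.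
  have e1 : expR (q / 2) <= 1 + q.
    have := expR_ge1Dx (- (q / 2)); rewrite expRN => e2.
    have q2 : 0 < 1 + - (q / 2) by lra.
    move: e2; rewrite -[leLHS]invrK lef_pV2 ?posrE ?invr_gt0 ?expR_gt0// => e2.
    apply: (le_trans e2); rewrite -[leLHS]mul1r ler_pdivrMr//.
    nra.
  rewrite expRN ler_pdivlMl ?expR_gt0//.
  by apply: le_trans half; rewrite ler_wpM2r ?wt_ge0.
have GE eta : (G eta `<=` evens Lam)%fset by apply/fsubsetP => x; rewrite GP => /andP[].
apply: (wt_random_subset beta0 (E := evens Lam) (G' := fun eta => G (raise Lam (-1) eta))) => //.
  by rewrite expR_ge0 /= -[leRHS]expR0 ler_expR oppr_le0 divr_ge0// ltW.
move=> G0 G0E; apply: (le_trans (shift G0)); rewrite -mulrA ler_wpM2l ?expR_ge0//.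
apply: (le_trans (reopen G0 G0 (fset_uniq _) _ G0E)) => //.
rewrite ler_wpM2l ?exprn_ge0 ?expR_ge0//; apply: wt_le => // eta _ [A1 A2 A3]; split=> //.
move=> y yL; by have [/A2//|/(A1 _ yL)] := boolP (y \in G0); exact: le_trans.
Qed.

End lower_bounds.

Section deep_sites.
Context {R : realType}.
Variables (beta : R) (Lam : {fset site}).
Hypothesis beta0 : 0 < beta.

Local Notation wt := (wt beta Lam).

Lemma wt_markov (G : config -> {fset site}) (E : {fset site}) (N : nat) (c : R) :
  (forall eta, (G eta `<=` E)%fset) ->
  (forall x, x \in E -> wt [set eta | x \in G eta] <= c) ->
  N%:R * wt [set eta | (N <= #|` G eta|)%N] <= #|` E|%:R * c.
Proof.
move=> GE Gc.
have part V : wt V = \sum_(G0 <- fpowerset E) wt (V `&` [set eta | G eta = G0]).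
  rewrite wt_partition ?fset_uniq//; congr (wt _).
  apply/seteqP; split=> [eta Ve|eta []//]; split=> //=.
  by rewrite fpowersetE.
apply: (@le_trans _ _ (\sum_(x <- E) wt [set eta | x \in G eta])); last first.
  apply: (@le_trans _ _ (\sum_(x <- E) c)).
    by rewrite big_seq [leRHS]big_seq; apply: ler_sum => x; exact: Gc.
  by rewrite big_const_seq count_predT iter_addr_0 -[leLHS]mulr_natl.
under eq_bigr do rewrite part.
rewrite part exchange_big /= mulr_sumr big_seq [leRHS]big_seq.
apply: ler_sum => G0; rewrite fpowersetE => G0E.
set w := wt [set eta | G eta = G0].
have [NG|GN] := leqP N #|` G0|; last first.
  apply: (@le_trans _ _ 0); last by apply: sumr_ge0 => x _; exact: wt_ge0.
  rewrite mulr_ge0_le0// -(mul0r (wt setT)) (wt_transport beta0 (f := id))//.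
  by move=> eta _ [/= NG e]; move: NG; rewrite e leqNgt GN.
apply: (@le_trans _ _ (\sum_(x <- G0) w)).
  rewrite big_const_seq count_predT iter_addr_0 -[leRHS]mulr_natl.
  apply: ler_pM; rewrite ?wt_ge0// ?ler_nat//.
  by apply: wt_le => // eta _ [].
rewrite [leRHS](bigID (mem G0)) /= -[leLHS]addr0; apply: lerD; last first.
  by apply: sumr_ge0 => x _; exact: wt_ge0.
rewrite -[leRHS]big_filter [leRHS](perm_big (enum_fset G0)) /=; last first.
  apply: uniq_perm; rewrite ?filter_uniq ?fset_uniq// => x; rewrite mem_filter.
  by case: (boolP (x \in G0)) => //= /(fsubsetP G0E) ->.
rewrite big_seq [leRHS]big_seq; apply: ler_sum => x xG.
by apply: wt_le => // eta _ /= e; split=> //=; rewrite e.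
Qed.

(** If the neighbours of [x] have average below [- M], one of them has height
    below [- M]; this has small probability for every site, and Markov's
    inequality bounds the number of such [x]. *)
Lemma few_deep_sites (M N : nat) : small_contours beta (expR (- beta)) -> hole_free Lam ->
  N%:R * wt [set eta | (N <= #|` [fset x in evens Lam |
     (nbr_sum eta x < - (4 * M%:Z))%R]%fset|)%N] <=
  #|` evens Lam|%:R * (8 * (expR (- beta) ^+ 4) ^+ M * wt setT).
Proof.
move=> small Lh; apply: wt_markov => [eta|x xE].
  by apply/fsubsetP => x; rewrite !inE => /andP[].
apply: (@le_trans _ _ (\sum_(y <- nbrs x) wt [set eta | eta y <= 0 - M%:Z /\ y \in Lam])).
  apply: wt_cover => // eta eta0; rewrite /= !inE => /andP[_ sx].
  apply: contrapT => deep; move: sx; apply/negP; rewrite -leNgt.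
  have -> : - (4 * M%:Z) = \sum_(y <- nbrs x) (- M%:Z) by rewrite nbrs4; lia.
  rewrite /nbr_sum big_seq [leRHS]big_seq; apply: ler_sum => y yx.
  have [yL|/eta0 ->] := boolP (y \in Lam); last by rewrite oppr_le0.
  rewrite leNgt; apply/negP => ey; apply: deep; exists y => //=; split=> //.
  by rewrite sub0r ltW.
rewrite (_ : 8 * _ * _ = \sum_(y <- nbrs x) (2 * (expR (- beta) ^+ 4) ^+ M * wt setT)); last first.
  by rewrite nbrs4 -mulr_natl; ring.
rewrite big_seq [leRHS]big_seq; apply: ler_sum => y _.
have [yL|yL] := boolP (y \in Lam); last first.
  apply: (@le_trans _ _ 0); last by rewrite !mulr_ge0 ?exprn_ge0 ?expR_ge0 ?wt_ge0.
  rewrite -(mul0r (wt setT)) (wt_transport beta0 (f := id))//.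
  by move=> eta _ /= [].
apply: (@le_trans _ _ (wt (setT `&` [set eta : config | eta y <= 0 - M%:Z]))).
  by apply: wt_le => // eta _ [? _]; split.
apply: (lower_tail beta0 small (fsubset_refl _)) => // eta b eta0 _.
rewrite in_bdry; case: (boolP (src b \in Lam)) => [_|/eta0 -> _]; last by left.
by case: (boolP (tgt b \in Lam)) => // /eta0 -> _; right.
Qed.

End deep_sites.

Lemma card_evens_box L : (L./2 * L./2 <= #|` evens (box L)|)%N.
Proof.
pose s : seq site := [seq ((2 * i)%N%:Z, (2 * j)%N%:Z) | i <- iota 1 L./2, j <- iota 1 L./2].
have -> : (L./2 * L./2 = size s)%N by rewrite size_allpairs size_iota.
apply: uniq_leq_size.
  apply: allpairs_uniq; rewrite ?iota_uniq// => -[i j] [i' j'] _ _ /= [e1 e2].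
  by congr (_, _); lia.
move=> _ /allpairsP[[i j] /= [ii jj ->]]; rewrite !mem_iota in ii jj.
rewrite !inE in_box /even_site /=.
lia.
Qed.

(** * Bounds for the maximum in a box *)

Lemma bigmax_attained (eta : config) z (s : seq site) :
  exists2 x, x \in z :: s & \big[Order.max/eta z]_(y <- s) eta y = eta x.
Proof.
elim: s => [|y s [x xs e]]; first by exists z; rewrite ?inE ?big_nil.
rewrite big_cons e maxElt; case: ifP => _.
  by exists x => //; move: xs; rewrite !inE => /orP[->|->]; rewrite ?orbT.
by exists y => //; rewrite !inE eqxx orbT.
Qed.

Lemma max_height_attained L eta : (0 < L)%N ->
  exists2 x, x \in box L & max_height L eta = eta x.
Proof.
move=> L0; have [x xL e] := bigmax_attained eta (1, 1) (enum_fset (box L)).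
exists x => //; move: xL; rewrite inE => /orP[/eqP ->|//].
by rewrite in_box /=; lia.
Qed.

Lemma le_max_height L eta x : x \in box L -> eta x <= max_height L eta.
Proof.
move=> xL; have : x \in enum_fset (box L) by [].
rewrite /max_height; elim: (enum_fset (box L)) => // y s IH.
rewrite inE big_cons le_max => /orP[/eqP ->|/IH ->]; rewrite ?lexx ?orbT//.
Qed.

Lemma card_box L : (#|` box L| <= L ^ 2)%N.
Proof.
pose s : seq site := [seq (i%:Z, j%:Z) | i <- iota 1 L, j <- iota 1 L].
have -> : (L ^ 2 = size s)%N by rewrite size_allpairs size_iota mulnn.
apply: uniq_leq_size; first exact: fset_uniq.
move=> [a c]; rewrite in_box /= => ac; apply/allpairsP.
by exists (absz a, absz c); split; rewrite ?mem_iota /=; [lia|lia|congr (_, _); lia].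
Qed.

Lemma entropy_beats_energy (R : realType) (beta l p : R) :
  2 * (4 * beta + 1) * l <= p -> 4 * beta * l - p / 2 <= - l.
Proof. by lra. Qed.

Lemma half_split (n p q : nat) : (n <= p + q)%N -> (p < n./2)%N -> (n./2 <= q)%N.
Proof. by lia. Qed.

Lemma half_quarter (n : nat) : (0 < n./2)%N -> (n <= 4 * n./2)%N.
Proof. by lia. Qed.

Lemma ler_intN4 (R : realType) (M : nat) (s : int) :
  (4 * (- M%:R) <= s%:~R :> R) = (- (4 * M%:Z) <= s).
Proof. by rewrite -(ler_int R) rmorphN rmorphM /= mulrN. Qed.

Section assembly.
Context {R : realType}.
Variables (beta d : R) (L : nat).
Hypothesis beta0 : 0 < beta.
Hypothesis small : small_contours beta (expR (- (beta - 4))).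
Hypothesis d0 : 0 < d.
Hypothesis dP : (\esum_(v in [set: int]) (expR (- beta) ^+ `|v|)%:E <= d%:E)%E.
Hypothesis L0 : (0 < L)%N.

Local Notation wt := (wt beta (box L)).
Local Notation a := (expR (- beta) ^+ 4).
Local Notation lnL := (ln L%:R).

Let small0 : small_contours beta (expR (- beta)).
Proof. by apply: small_contours_le small; rewrite ?expR_ge0// ler_expR; lra. Qed.

Let bn0 : beta != 0.
Proof. by rewrite gt_eqF. Qed.

Let expR_lnL : expR lnL = L%:R :> R.
Proof. by rewrite lnK// posrE ltr0n. Qed.

Let aE n : a ^+ n = expR (- (4 * beta * n%:R)).
Proof. by rewrite -!expRM_natr; congr expR; ring. Qed.

Lemma max_union (S : set config) (H k : nat) :
  (forall x, x \in box L ->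
     wt (S `&` [set eta | H%:Z + k%:Z <= eta x]) <= 2 * a ^+ k * wt S) ->
  wt (S `&` [set eta | H%:Z + k%:Z <= max_height L eta]) <=
  L%:R ^+ 2 * (2 * a ^+ k * wt S).
Proof.
move=> Sx; apply: (@le_trans _ _ (\sum_(x <- box L)
    wt (S `&` [set eta | H%:Z + k%:Z <= eta x]))).
  apply: wt_cover => // eta _ [Se /= e].
  have [x xL ex] := max_height_attained eta L0.
  by exists x => //; split=> //=; rewrite -ex.
apply: (@le_trans _ _ (\sum_(x <- box L) (2 * a ^+ k * wt S))).
  by rewrite big_seq [leRHS]big_seq; apply: ler_sum => x; exact: Sx.
rewrite big_const_seq count_predT iter_addr_0 -[leLHS]mulr_natl.
rewrite ler_wpM2r ?mulr_ge0 ?exprn_ge0 ?expR_ge0 ?wt_ge0// -natrX ler_nat.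
exact: card_box.
Qed.

(** Union bound over the box. The factor [expR (8 beta)] pays for rounding the
    threshold to an integer. *)
Lemma nofloor_max_upper (K : R) : 0 <= K ->
  wt [set eta | (2 * beta)^-1 * lnL + K <= (max_height L eta)%:~R] <=
  2 * expR (8 * beta) * expR (- (4 * beta * K)) * wt setT.
Proof.
have b0 : 0 < beta := beta0.
move=> K0; set t := _ * lnL + K.
have lnL0 : 0 <= lnL :> R by rewrite ln_ge0// ler1n.
have t0 : 0 <= t by rewrite addr_ge0// mulr_ge0// invr_ge0 mulr_ge0// ltW.
have /andP[kt tk] := truncn_itv t0; set k := Num.truncn t in kt tk.
apply: (@le_trans _ _ (wt (setT `&` [set eta | 0%N%:Z + k%:Z <= max_height L eta]))).
  apply: wt_le => // eta _ /= e; split=> //=; rewrite add0r -(ler_int R).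
  by apply: le_trans e; rewrite -pmulrn.
apply: le_trans (max_union (S := setT) (H := 0) (k := k) _) _.
  move=> x xL; apply: le_trans (nofloor_upper_tail beta0 k small0 (@box_hole_free L) xL).
  by apply: wt_le => // eta _ [_] /=; rewrite add0r.
rewrite mulrA ler_wpM2r ?wt_ge0// mulrCA -!mulrA ler_wpM2l//.
rewrite aE -expR_lnL -!expRD ler_expR.
have tE : beta * t = lnL / 2 + beta * K by rewrite /t; field; exact: bn0.
have : beta * t <= beta * k.+1%:R by rewrite ler_wpM2l ?ltW.
rewrite -natr1; lra.
Qed.

(** Union bound above the least level [H] for which [floor_upper_tail] applies;
    rounding [H] as well costs a second unit of height. *)
Lemma floor_max_upper (K : R) : 4 * expR (- beta) ^+ 4 <= 1 -> 2 <= K ->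
  wt (nonneg_on (box L) `&` [set eta | 3 / (4 * beta) * lnL + K <= (max_height L eta)%:~R]) <=
  2 * expR (8 * beta) * expR (- (4 * beta * K)) * wt (nonneg_on (box L)).
Proof.
have b0 : 0 < beta := beta0.
move=> beta4 K0; set t := _ * lnL + K.
have lnL0 : 0 <= lnL :> R by rewrite ln_ge0// ler1n.
set u := (4 * beta)^-1 * lnL.
have u0 : 0 <= u by rewrite mulr_ge0// invr_ge0 mulr_ge0// ltW.
have /andP[Hu uH] := truncn_itv u0; set H := (Num.truncn u).+1 in Hu uH.
have tu : t = 3 * u + K by rewrite /t /u; field; exact: bn0.
have Hu1 : H%:R <= u + 1 by rewrite /H -natr1 lerD2r.
have tH0 : 0 <= t - H%:R by rewrite tu; lra.
have /andP[kt tk] := truncn_itv tH0; set k := Num.truncn (t - H%:R) in kt tk.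
have ub : 4 * beta * u = lnL by rewrite /u; field; exact: bn0.
apply: (@le_trans _ _ (wt (nonneg_on (box L) `&` [set eta | H%:Z + k%:Z <= max_height L eta]))).
  apply: wt_le => // eta _ [Fe /= e]; split=> //=; rewrite -(ler_int R) intrD -!pmulrn.
  by apply: le_trans e; lra.
apply: le_trans (max_union (S := nonneg_on (box L)) (H := H) (k := k) _) _.
  move=> x xL; apply: (floor_upper_tail beta0 (erefl _) small) => //.
  rewrite aE -[X in X * _]expR_lnL -expRD -[leRHS]expR0 ler_expR.
  have : 4 * beta * u <= 4 * beta * H%:R by rewrite ler_wpM2l ?ltW// mulr_gt0.
  lra.
rewrite mulrA ler_wpM2r ?wt_ge0// mulrCA -!mulrA ler_wpM2l//.
rewrite aE -expR_lnL -!expRD ler_expR.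
have h1 : 4 * beta * (2 * u + K - 2) <= 4 * beta * k%:R.
  rewrite ler_wpM2l ?mulr_ge0 ?(ltW beta0)//.
  by move: tk; rewrite -natr1 tu; lra.
lra.
Qed.

Let n := #|` evens (box L)|.
Let N := n./2.
(* [N] trials of success probability [p] have [c1 * expR (4 * beta * M) <= p * N] *)
Let c1 := (32 * d * expR (4 * beta))^-1.

Let c1_gt0 : 0 < c1.
Proof. by rewrite invr_gt0 !mulr_gt0 ?expR_gt0. Qed.

Let half_evens : (8 <= L)%N -> L%:R ^+ 2 <= 32 * N%:R :> R.
Proof.
move=> L8; rewrite -natrX -[32]/(32%:R) -natrM ler_nat.
have := card_evens_box L; rewrite -/n /N => mn.
have Lm : (L <= (L./2).*2.+1)%N by lia.
have : (L ^ 2 <= (L./2).*2.+1 ^ 2)%N by rewrite leq_exp2r.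
have nN : (n <= (n./2).*2.+1)%N by lia.
have m4 : (4 <= L./2)%N by lia.
move: (L./2) (n./2) m4 mn nN => m p m4 mn nN.
rewrite -!mulnn => h; apply: (leq_trans h); nia.
Qed.

Let trial_bound (h : R) (k M : nat) : (8 <= L)%N ->
  beta * (4 * k%:R - 4 * h) <= 2 * lnL + 4 * beta - 4 * beta * M%:R ->
  expR (- (d * expR (beta * (4 * k%:R - 4 * h)))^-1) ^+ N <=
  expR (- (c1 * expR (4 * beta * M%:R))).
Proof.
move=> L8 hk; rewrite -expRM_natr ler_expR mulNr lerN2.
have LN := half_evens L8; set y := expR (4 * _ * _).
have y0 : 0 < y by exact: expR_gt0.
have LL : 0 < L%:R ^+ 2 :> R by rewrite exprn_gt0// ltr0n.
set p := (d * _)^-1.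
have p0 : 0 < p by rewrite invr_gt0 mulr_gt0 ?expR_gt0.
have pL : 32 * c1 * y <= p * L%:R ^+ 2.
  have dn0 : d != 0 by rewrite gt_eqF.
  have en0 x : expR x != 0 :> R by rewrite gt_eqF ?expR_gt0.
  have -> : 32 * c1 * y = d^-1 * expR (4 * beta * M%:R - 4 * beta).
    by rewrite /c1 /y expRD expRN; field; rewrite dn0 en0.
  have -> : p * L%:R ^+ 2 = d^-1 * expR (lnL + lnL - beta * (4 * k%:R - 4 * h)).
    by rewrite /p !expRD expRN expR_lnL; field; rewrite dn0 en0.
  apply: ler_wpM2l; first by rewrite invr_ge0 ltW.
  by rewrite ler_expR; lra.
have : p * L%:R ^+ 2 <= p * (32 * N%:R) by rewrite ler_wpM2l// ltW.
lra.
Qed.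

(** Either few even sites have neighbours of average at least [- M], which gives
    the second error term, or all of the many that do fail to exceed the
    threshold, which gives the first. *)
Lemma nofloor_max_lower (M : nat) : (8 <= L)%N -> 4 * beta * M%:R <= lnL ->
  wt [set eta | (max_height L eta)%:~R <= (2 * beta)^-1 * lnL - 2 * M%:R] <=
  (expR (- (c1 * expR (4 * beta * M%:R))) + 32 * expR (- (4 * beta * M%:R))) * wt setT.
Proof.
have b0 : 0 < beta := beta0.
move=> L8 ML; set t := _ - _.
have tE : beta * t = lnL / 2 - 2 * (beta * M%:R) by rewrite /t; field; exact: bn0.
have t0 : 0 <= t by rewrite -(pmulr_rge0 _ b0) tE; lra.
have /andP[kt tk] := truncn_itv t0; set k := (Num.truncn t).+1 in tk.
have kt1 : k%:R <= t + 1 by rewrite /k -natr1 lerD2r.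
pose good eta := [fset x in evens (box L) | (4 * (- M%:R) <= (nbr_sum eta x)%:~R :> R)%R]%fset.
pose bad eta := [fset x in evens (box L) | (nbr_sum eta x < - (4 * M%:Z))%R]%fset.
pose low := [set eta : config | forall x, x \in box L -> eta x < k%:Z].
apply: (@le_trans _ _ (wt ((setT `&` low `&` [set eta | (N <= #|` good eta|)%N]) `|`
    [set eta | (N <= #|` bad eta|)%N]))).
  apply: wt_le => // eta _ /= Xt.
  have [Ng|Ng] := leqP N #|` good eta|.
    left; split=> //; split=> // x /(le_max_height eta) ex.
    rewrite -(ltr_int R) -pmulrn; apply: le_lt_trans tk; apply: le_trans Xt.
    by rewrite ler_int.
  right; have gb : evens (box L) = (good eta `|` bad eta)%fset.
    apply/fsetP => x; rewrite in_fsetU !inE /=; case: (x \in box L) => //=.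
    case: (even_site x) => //=.
    by rewrite ler_intN4 leNgt; case: (_ < _).
  have : (n <= #|` good eta| + #|` bad eta|)%N.
    by rewrite /n {1}gb cardfsU leq_subr.
  by move=> /half_split /(_ Ng).
apply: (le_trans (@wtU _ _ _ beta0 _ _)); rewrite mulrDl; apply: lerD.
  apply: le_trans (@max_ge _ _ _ _ beta0 d0 dP setT k%:Z (- M%:R) N _ _) _ => //.
  rewrite ler_wpM2r ?wt_ge0//; apply: trial_bound => //.
  have : beta * k%:R <= beta * (t + 1) by apply: ler_wpM2l; first exact: ltW.
  lra.
have LN := half_evens L8.
have N0 : 0 < N%:R :> R.
  have : 0 < L%:R ^+ 2 :> R by rewrite exprn_gt0// ltr0n.
  lra.
have := few_deep_sites beta0 M N small0 (@box_hole_free L).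
rewrite -/n aE; set w := wt setT; set w' := wt _ => h.
rewrite -(ler_pM2l N0); apply: (le_trans h).
have nN : n%:R <= 4 * N%:R :> R.
  rewrite -[4]/(4%:R) -natrM ler_nat; apply: half_quarter.
  by rewrite -(ltr0n R).
have e0 : 0 <= 8 * expR (- (4 * beta * M%:R)) * w.
  by rewrite !mulr_ge0 ?expR_ge0 ?wt_ge0.
apply: (le_trans (ler_wpM2r e0 nN)).
by rewrite le_eqVlt; apply/orP; left; apply/eqP; ring.
Qed.

(** Neighbours of average at most [h = ln L / (4 beta) - M] count as low. With at
    least [N] such sites the entropy gain [c1 * expR (4 * beta * M) * L / 2]
    exceeds the perimeter cost [4 beta L] by [L]; with fewer, the trials at the
    other even sites all fail. *)
Lemma floor_max_lower (M : nat) : (8 <= L)%N -> 4 * beta * M%:R <= lnL ->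
  32 * c1 * expR (4 * beta * M%:R) <= L%:R ->
  2 * (4 * beta + 1) <= c1 * expR (4 * beta * M%:R) ->
  wt (nonneg_on (box L) `&`
    [set eta | (max_height L eta)%:~R <= 3 / (4 * beta) * lnL - 2 * M%:R]) <=
  (expR (- (c1 * expR (4 * beta * M%:R))) + expR (- L%:R)) * wt (nonneg_on (box L)).
Proof.
have b0 : 0 < beta := beta0.
move=> L8 ML ML' Mc; set t := _ - _.
have lnL0 : 0 <= lnL :> R by rewrite ln_ge0// ler1n.
have tE : beta * t = 3 / 4 * lnL - 2 * (beta * M%:R) by rewrite /t; field; exact: bn0.
have t0 : 0 <= t by rewrite -(pmulr_rge0 _ b0) tE; lra.
have /andP[kt tk] := truncn_itv t0; set k := (Num.truncn t).+1 in tk.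
have kt1 : k%:R <= t + 1 by rewrite /k -natr1 lerD2r.
pose h : R := (4 * beta)^-1 * lnL - M%:R.
have hE : beta * h = lnL / 4 - beta * M%:R by rewrite /h; field; exact: bn0.
pose good eta := [fset x in evens (box L) | (4 * h <= (nbr_sum eta x)%:~R :> R)%R]%fset.
pose bad eta := [fset x in evens (box L) | ((nbr_sum eta x)%:~R <= 4 * h :> R)%R]%fset.
pose low := [set eta : config | forall x, x \in box L -> eta x < k%:Z].
apply: (@le_trans _ _ (wt ((nonneg_on (box L) `&` low `&` [set eta | (N <= #|` good eta|)%N]) `|`
    (nonneg_on (box L) `&` [set eta | (N <= #|` bad eta|)%N])))).
  apply: wt_le => // eta _ [Fe /= Xt].
  have [Ng|Ng] := leqP N #|` good eta|.
    left; split=> //; split=> // x /(le_max_height eta) ex.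
    rewrite -(ltr_int R) -pmulrn; apply: le_lt_trans tk; apply: le_trans Xt.
    by rewrite ler_int.
  right; split=> //; have gb : evens (box L) = (good eta `|` bad eta)%fset.
    apply/fsetP => x; rewrite in_fsetU !inE /=; case: (x \in box L) => //=.
    by case: (even_site x) => //=; rewrite le_total.
  have : (n <= #|` good eta| + #|` bad eta|)%N.
    by rewrite /n {1}gb cardfsU leq_subr.
  by move=> /half_split /(_ Ng).
apply: (le_trans (@wtU _ _ _ beta0 _ _)); rewrite mulrDl; apply: lerD.
  apply: le_trans (@max_ge _ _ _ _ beta0 d0 dP (nonneg_on (box L)) k%:Z h N _ _) _ => //.
    by move=> eta x _ Fe y yL; rewrite /upd; case: eqP => // _; exact: Fe.
  rewrite ler_wpM2r ?wt_ge0//; apply: trial_bound => //.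
  have : beta * k%:R <= beta * (t + 1) by apply: ler_wpM2l; first exact: ltW.
  lra.
have LN := half_evens L8.
have L1 : 0 < L%:R :> R by rewrite ltr0n.
set y := expR (4 * beta * M%:R) in ML' Mc *.
have y0 : 0 < y by exact: expR_gt0.
have qE : (d * expR (beta * (4 * h + 4)))^-1 = 32 * c1 * y / L%:R.
  have -> : beta * (4 * h + 4) = lnL + 4 * beta - 4 * beta * M%:R.
    have -> : beta * (4 * h + 4) = 4 * (beta * h) + 4 * beta by ring.
    by rewrite hE; lra.
  rewrite !expRD expR_lnL expRN -/y /c1.
  field.
  by rewrite !gt_eqF ?expR_gt0.
have := @few_low_sites _ _ (box L) _ beta0 d0 dP h N; rewrite /= qE.
have -> : (32 * c1 * y / L%:R <= 1) = true by rewrite ler_pdivrMr// mul1r.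
move=> /(_ isT) few; apply: (le_trans few); rewrite ler_wpM2r ?wt_ge0//.
rewrite -expRM_natr -expRD ler_expR.
have bL : beta * #|` bdry (box L)|%:R <= 4 * beta * L%:R.
  have bn : #|` bdry (box L)|%:R <= 4 * L%:R :> R.
    by rewrite -[4]/(4%:R) -natrM ler_nat card_bdry_box.
  rewrite [leRHS](_ : _ = beta * (4 * L%:R)); last by ring.
  by apply: ler_wpM2l => //; exact: ltW.
have qN : c1 * y * L%:R / 2 <= 32 * c1 * y / L%:R / 2 * N%:R.
  have -> : c1 * y * L%:R / 2 = c1 * y / L%:R / 2 * L%:R ^+ 2.
    by field; rewrite gt_eqF.
  rewrite [leRHS](_ : _ = c1 * y / L%:R / 2 * (32 * N%:R)); last by ring.
  apply: ler_wpM2l => //.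
  by rewrite !divr_ge0// mulr_ge0 ?(ltW c1_gt0) ?(ltW y0).
have : 2 * (4 * beta + 1) * L%:R <= c1 * y * L%:R by apply: ler_wpM2r => //; exact: ltW.
by move=> /entropy_beats_energy; rewrite mulNr; exact: le_trans (lerB bL qN).
Qed.

End assembly.

(** * Tightness and convergence *)

(** Tightness suffices: a diverging threshold eventually exceeds any constant. *)
Lemma tight_cvg (R : realType) (mu : nat -> probability config R) (X : nat -> config -> R)
    (phi : nat -> R) :
  (forall e : R, 0 < e -> exists (K : R) (L0 : nat), forall L, (L0 <= L)%N ->
     (mu L [set eta | (K <= `|X L eta|)%R] <= e%:E)%E) ->
  phi L @[L --> \oo] --> +oo ->
  mu L [set eta | phi L <= `|X L eta|] @[L --> \oo] --> 0%E.
Proof.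
move=> tight phioo; apply/fine_cvgP; split.
  by near=> L; exact: fin_num_measure.
apply/cvgr0Pnorm_le => e e0.
have [K [L0 KL]] := tight _ e0.
have /cvgryPge/(_ K) phiK := phioo.
near=> L.
have LL0 : (L0 <= L)%N by near: L; exists L0.
have KphiL : K <= phi L by near: L.
rewrite ger0_norm ?fine_ge0// -lee_fin fineK; last exact: fin_num_measure.
apply: le_trans (KL _ LL0); apply: le_measure; rewrite ?inE//.
by move=> eta /= h; exact: le_trans h.
Unshelve. all: by end_near. Qed.

Lemma exists_scale (R : realType) (beta C D : R) : 0 < beta -> exists M : nat,
  (1 <= M)%N /\ C + D <= expR (4 * beta * M%:R).
Proof.
move=> b0; exists (Num.truncn (`|C + D| / (4 * beta))).+1; split=> //.
have b4 : 0 < 4 * beta by rewrite mulr_gt0.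
have /andP[_ h] := truncn_itv (x := `|C + D| / (4 * beta)) (divr_ge0 (normr_ge0 _) (ltW b4)).
move: h; rewrite ltr_pdivrMr// mulrC => h.
have := expR_ge1Dx (4 * beta * (Num.truncn (`|C + D| / (4 * beta))).+1%:R).
have := ler_norm (C + D); lra.
Qed.

Lemma expRN_le_inv (R : realType) (x : R) : 0 < x -> expR (- x) <= x^-1.
Proof.
move=> x0; rewrite expRN lef_pV2 ?posrE ?expR_gt0//.
by have := expR_ge1Dx x; lra.
Qed.

Section tightness.
Context {R : realType}.
Variables (beta d : R).
Hypothesis beta0 : 0 < beta.
Hypothesis small : small_contours beta (expR (- (beta - 4))).
Hypothesis beta4 : 4 * expR (- beta) ^+ 4 <= 1.
Hypothesis d0 : 0 < d.
Hypothesis dP : (\esum_(v in [set: int]) (expR (- beta) ^+ `|v|)%:E <= d%:E)%E.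

Let c1 := (32 * d * expR (4 * beta))^-1.

Let c1_gt0 : 0 < c1.
Proof. by rewrite invr_gt0 !mulr_gt0 ?expR_gt0. Qed.

(* every error term of the bounds in a box is at most a constant multiple of
   [expR (- (4 * beta * M))]; these constants add up to [C] *)
Let C := 2 * expR (8 * beta) + c1^-1 + 33.

Let scale (e : R) : 0 < e -> exists M : nat, [/\ (1 <= M)%N,
   C / e <= expR (4 * beta * M%:R),
   2 * (4 * beta + 1) <= c1 * expR (4 * beta * M%:R) &
   2 * expR (8 * beta) * expR (- (4 * beta * (2 * M%:R))) +
     (expR (- (c1 * expR (4 * beta * M%:R))) +
      32 * expR (- (4 * beta * M%:R)) + (expR (4 * beta * M%:R))^-1) <= e].
Proof.
have b0 : 0 < beta := beta0.
move=> e0; have C0 : 0 < C.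
  have : 0 < c1^-1 by rewrite invr_gt0.
  by have := expR_gt0 (8 * beta); rewrite /C; lra.
have [M [M1 My]] := exists_scale (C / e) (2 * (4 * beta + 1) / c1) beta0.
exists M; set y := expR _ in My *.
have y0 : 0 < y by exact: expR_gt0.
have Ce : 0 <= C / e by rewrite divr_ge0// ltW.
have bc : 0 <= 2 * (4 * beta + 1) / c1 by rewrite divr_ge0 ?(ltW c1_gt0)//; lra.
have Cy : C / e <= y by lra.
split=> //; first by rewrite [leRHS]mulrC -ler_pdivrMr//; lra.
have E1 : expR (- (c1 * y)) <= c1^-1 * y^-1.
  by rewrite -invfM mulrC [y * _]mulrC expRN_le_inv// mulr_gt0.
have E2 : expR (- (4 * beta * M%:R)) = y^-1 by rewrite expRN.
have E3 : expR (- (4 * beta * (2 * M%:R))) <= y^-1.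
  rewrite -E2 ler_expR lerN2 ler_wpM2l ?mulr_ge0 ?(ltW b0)//.
  by have : 0 <= M%:R :> R by []; lra.
have Cye : C * y^-1 <= e.
  by rewrite ler_pdivrMr// mulrC -ler_pdivrMr.
have E4 : 2 * expR (8 * beta) * expR (- (4 * beta * (2 * M%:R))) <=
    2 * expR (8 * beta) * y^-1 by rewrite ler_wpM2l// mulr_ge0// expR_ge0.
rewrite E2; apply: le_trans Cye; rewrite /C; lra.
Qed.

Let large (M : nat) : exists L0 : nat, forall L, (L0 <= L)%N ->
  [/\ (8 <= L)%N, (0 < L)%N, 4 * beta * M%:R <= ln L%:R,
      32 * c1 * expR (4 * beta * M%:R) <= L%:R &
      expR (- L%:R) <= (expR (4 * beta * M%:R))^-1 :> R].
Proof.
set y := expR _; have y0 : 0 < y by exact: expR_gt0.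
have cy : 0 <= 32 * c1 * y by rewrite !mulr_ge0// ltW.
pose z := 8 + y + 32 * c1 * y.
have z0 : 0 <= z by rewrite /z; lra.
exists (Num.truncn z).+1 => L zL.
have /andP[_ zt] := truncn_itv z0.
have {}zL : z <= L%:R.
  by apply: (le_trans (ltW zt)); rewrite ler_nat.
have L8 : (8 <= L)%N by rewrite -(ler_nat R); apply: le_trans zL; rewrite /z; lra.
have L0 : 0 < L%:R :> R by rewrite ltr0n; exact: leq_trans L8.
have yL : y <= L%:R by apply: le_trans zL; rewrite /z; lra.
split=> //.
- exact: leq_trans L8.
- by rewrite -ler_expR lnK.
- by apply: le_trans zL; rewrite /z; lra.
- by apply: le_trans (expRN_le_inv L0) _; rewrite lef_pV2.
Qed.

Let deviation (L : nat) (S : set config) (c K r1 r2 : R) : (0 < wt beta (box L) S) ->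
  wt beta (box L) (S `&` [set eta | c + K <= (max_height L eta)%:~R]) <=
     r1 * wt beta (box L) S ->
  wt beta (box L) (S `&` [set eta | (max_height L eta)%:~R <= c - K]) <=
     r2 * wt beta (box L) S ->
  wt beta (box L) (S `&` [set eta | K <= `|(max_height L eta)%:~R - c|]) /
    wt beta (box L) S <= r1 + r2.
Proof.
move=> S0 up lo; rewrite ler_pdivrMr// mulrDl.
apply: le_trans (lerD up lo); apply: le_trans (@wtU _ _ _ beta0 _ _).
apply: wt_le => // eta _ [Se]; rewrite /= ler_normr => /orP[h|h]; [left|right]; split=> //=.
  by rewrite -lerBrDl.
by rewrite lerBrDl -lerBrDr -opprB.
Qed.

Lemma nofloor_tight (e : R) : 0 < e -> exists (K : R) (L0 : nat), forall L, (L0 <= L)%N ->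
  (sos_nofloor beta (box L)
     [set eta | (K <= `|(max_height L eta)%:~R - (2 * beta)^-1 * ln L%:R|)%R] <= e%:E)%E.
Proof.
move=> e0; have [M [M1 _ _ Me]] := scale e0; have [L0 LM] := large M.
exists (2 * M%:R), L0 => L /LM[L8 Lgt0 ML _ _].
rewrite sos_nofloorE// lee_fin; apply: le_trans Me.
have M0 : 0 <= 2 * M%:R :> R by rewrite mulr_ge0.
rewrite -[X in wt _ _ X / _](setTI _).
apply: le_trans (deviation (r1 := 2 * expR (8 * beta) * expR (- (4 * beta * (2 * M%:R))))
   (r2 := expR (- (c1 * expR (4 * beta * M%:R))) + 32 * expR (- (4 * beta * M%:R))) _ _ _) _.
- exact: wt_gt0.
- by rewrite setTI; exact: nofloor_max_upper.
- by rewrite setTI; exact: (nofloor_max_lower beta0 small d0 dP).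
- by rewrite lerD2l lerDl invr_ge0 expR_ge0.
Qed.

Lemma floor_tight (e : R) : 0 < e -> exists (K : R) (L0 : nat), forall L, (L0 <= L)%N ->
  (sos_floor beta (box L)
     [set eta | (K <= `|(max_height L eta)%:~R - 3 / (4 * beta) * ln L%:R|)%R] <= e%:E)%E.
Proof.
move=> e0; have [M [M1 _ Mb Me]] := scale e0; have [L0 LM] := large M.
exists (2 * M%:R), L0 => L /LM[L8 Lgt0 ML Mc ML'].
rewrite sos_floorE// lee_fin; apply: le_trans Me.
have M0 : 2 <= 2 * M%:R :> R by rewrite -[leLHS]mulr1 ler_wpM2l// ler1n.
apply: le_trans (deviation (r1 := 2 * expR (8 * beta) * expR (- (4 * beta * (2 * M%:R))))
   (r2 := expR (- (c1 * expR (4 * beta * M%:R))) + expR (- L%:R)) _ _ _) _.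
- by apply: wt_gt0.
- exact: floor_max_upper.
- exact: (floor_max_lower beta0 d0 dP).
- rewrite lerD2l -addrA lerD2l; apply: (le_trans ML').
  by rewrite lerDr mulr_ge0// expR_ge0.
Qed.

End tightness.

Theorem corollary1p2 (R : realType) :
  exists2 beta0 : R, 0 < beta0 &
  forall beta : R, beta0 <= beta ->
  forall phi : nat -> R, phi L @[L --> \oo] --> +oo ->
    (sos_nofloor beta (box L)
       [set eta | phi L <=
          `|(max_height L eta)%:~R - (2 * beta)^-1 * ln L%:R|]
       @[L --> \oo] --> 0%E) /\
    (sos_floor beta (box L)
       [set eta | phi L <=
          `|(max_height L eta)%:~R - 3 / (4 * beta) * ln L%:R|]
       @[L --> \oo] --> 0%E).
Proof.
have [b0 b0_gt0 b0P] := large_beta R.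
exists b0 => // beta bb phi phioo.
have beta0 : 0 < beta by exact: lt_le_trans bb.
have [small beta4] := b0P _ bb.
have [d [d0 dP]] : exists d : R, 0 < d /\
    (\esum_(v in [set: int]) (expR (- beta) ^+ `|v|)%:E <= d%:E)%E.
  by apply: int_geometric_bound; rewrite expR_ge0 expR_lt1 oppr_lt0.
split.
- apply: (tight_cvg (mu := fun L => sos_nofloor beta (box L))) => //.
  exact: nofloor_tight small d0 dP.
- apply: (tight_cvg (mu := fun L => sos_floor beta (box L))) => //.
  exact: floor_tight small beta4 d0 dP.
Qed.
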